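(* Let $1\le k\le n$ and let $f_1,\ldots,f_k,\phi_1,\ldots,\phi_n\in\mathcal{O}_{n,0}$, with $\phi_1,\ldots,\phi_n$ vanishing at $0$, satisfy $$\mu_j:=\operatorname{mult}(f_1,\ldots,f_j,\phi_{j+1},\ldots,\phi_n)<\infty,\qquad 1\le j\le k.$$ Then the map germ $\phi=(\phi_1,\ldots,\phi_n)$ and the filtration of ideals $I_j:=(f_1,\ldots,f_j)$, $1\le j\le k$, admit a triangular resolution $h=(h_1,\ldots,h_k)$ satisfying $$\operatorname{ord}_{w_j}h_j\le n\cdot\mu_j\cdot\operatorname{mult}(f_1,\ldots,f_j),\qquad 1\le j\le k.$$ In fact, each $h_j(w_j,\ldots,w_n)$ can be chosen as a Weierstrass polynomial in $w_j$.
   Context: $\mathcal{O}_{n,0}$ is the ring of germs at $0$ of holomorphic functions in $\mathbb{C}^n$. For $0\le k\le n$ and a $k$-tuple $\phi_1,\ldots,\phi_k\in\mathcal{O}_{n,0}$, $\operatorname{mult}(\phi_1,\ldots,\phi_k):=\min\dim_{\mathbb{C}}\mathcal{O}_{n,0}/(\phi_1,\ldots,\phi_k,L_1,\ldots,L_{n-k})$, the minimum being over $(n-k)$-tuples of linear functions $L_j$ on $\mathbb{C}^n$. A triangular resolution of length $k\ge1$ and multi-order $(\mu_1,\ldots,\mu_k)\in\mathbb{N}^k$ of a pair $(\Gamma,\mathcal{I})$, where $\Gamma\colon(\mathbb{C}^n,0)\to(\mathbb{C}^n,0)$ is a holomorphic map germ and $\mathcal{I}$ is a filtration of ideals $I_1\subset\ldots\subset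 I_k\subset\mathcal{O}_{n,0}$, is a system $(h_1,\ldots,h_k)$ of holomorphic function germs at $0\in\mathbb{C}^n$ such that for $1\le j\le k$: $h_j=h_j(w_j,\ldots,w_n)$ depends only on the last $n-j+1$ coordinates, $h_j\circ\Gamma\in I_j$, and $\operatorname{ord}_{w_j}h_j=\mu_j$, where $\operatorname{ord}_{w_j}h_j$ is the vanishing order at $0$ of $w_j\mapsto h_j(w_j,0,\ldots,0)$. *)

(* Defs.v *)
(* The complex numbers are R[i], for R : realType. *)
From HB Require Import structures.
From mathcomp Require Import all_boot all_order all_algebra finmap complex.
From mathcomp Require Import all_classical all_reals ereal topology normedtype.
From mathcomp Require Import summability.

Set Implicit Arguments.
Unset Strict Implicit.
Unset Printing Implicit Defensive.

Import Order.TTheory GRing.Theory Num.Theory.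
Import numFieldNormedType.Exports.

Local Open Scope classical_set_scope.
Local Open Scope ring_scope.

(* The library puts the norm topology on K^o for every numFieldType K,
   but does not transfer it to R[i] itself. *)
HB.instance Definition _ (R : rcfType) := NormedModule.copy R[i] R[i]^o.

(* Germs at 0 are handled through representatives: total functions on C^n,
   of which only the values near 0 matter.  Equality of germs is equality on a
   neighbourhood of 0, and every notion below is invariant under it. *)
Notation cfun R n := ('rV[R[i]]_n -> R[i]).
Notation linform R n := {linear 'rV[R[i]]_n -> R[i]^o}.

(* f is, near w, the sum of a power series centred at w; convergence is
   unconditional, i.e. along the directed set of finite sets of multi-indices,
   as usual for power series in several variables. *)
Definition analytic_at (R : realType) (n : nat) (f : cfun R n)
    (w : 'rV[R[i]]_n) : Prop :=
  exists a : {ffun 'I_n -> nat} -> R[i],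
    {near w, forall z : 'rV[R[i]]_n,
      partial_sum (fun alpha : {ffun 'I_n -> nat} =>
        a alpha * \prod_(i < n) (z 0 i - w 0 i) ^+ alpha i) @ totally --> f z}.

(* f represents an element of O_{n,0}: it is holomorphic on a neighbourhood
   of 0, in the sense of having a convergent power series expansion around
   each point of that neighbourhood. *)
Definition holo_germ (R : realType) (n : nat) (f : cfun R n) : Prop :=
  \forall w \near (0 : 'rV[R[i]]_n), analytic_at f w.

Definition ideal_of (R : realType) (n : nat) (s : seq (cfun R n)) :
    set (cfun R n) :=
  [set g | exists2 c : 'I_(size s) -> cfun R n,
    forall i, holo_germ (c i) &
    \forall z \near (0 : 'rV[R[i]]_n), g z = \sum_(i < size s) c i z * s`_i z].

(* The classes of e_0, ..., e_{d-1} form a C-basis of O_{n,0} / I. *)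
Definition quot_basis (R : realType) (n : nat) (I : set (cfun R n)) (d : nat)
    (e : 'I_d -> cfun R n) : Prop :=
  (forall i, holo_germ (e i)) /\
  forall g : cfun R n, holo_germ g ->
    exists! c : 'rV[R[i]]_d, I (fun z => g z - \sum_(i < d) c 0 i * e i z).

(* dim_C (O_{n,0} / I).  All finite bases have the same size, so the infimum is
   over a singleton or, when there is no finite basis, over set0: then it is
   +oo. *)
Definition quot_dim (R : realType) (n : nat) (I : set (cfun R n)) : \bar R :=
  ereal_inf [set d%:R%:E | d in
    [set d : nat | exists e : 'I_d -> cfun R n, quot_basis I e]].

(* The infimum is a minimum, since quot_dim takes values in N and +oo. *)
Definition mult (R : realType) (n : nat) (s : seq (cfun R n)) : \bar R :=
  ereal_inf [set quot_dim
      (ideal_of (s ++ [seq (l : cfun R n) | l : linform R n <- L])) |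
    L in [set: (n - size s).-tuple (linform R n)]].

(* As a germ, f depends only on the coordinates of (0-based) index >= p. *)
Definition depends_from (R : realType) (n p : nat) (f : cfun R n) : Prop :=
  {near (0 : 'rV[R[i]]_n) & (0 : 'rV[R[i]]_n), forall z z' : 'rV[R[i]]_n,
    (forall i : 'I_n, (p <= i)%N -> z 0 i = z' 0 i) -> f z = f z'}.

(* u vanishes at 0 to order exactly m: u(t) = t^m g(t) with g holomorphic and
   g(0) <> 0. *)
Definition vanishing_order (R : realType) (u : R[i] -> R[i]) (m : nat) : Prop :=
  exists2 g : cfun R 1, holo_germ g /\ g 0 != 0 &
    \forall t \near (0 : R[i]), u t = t ^+ m * g (const_mx t).

Definition ord_coord (R : realType) (n : nat) (j : 'I_n) (h : cfun R n)
    (m : nat) : Prop :=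
  vanishing_order (fun t => h (t *: delta_mx 0 j)) m.

Definition map_of (R : realType) (n : nat) (phi : n.-tuple (cfun R n))
    (z : 'rV[R[i]]_n) : 'rV[R[i]]_n :=
  \row_i tnth phi i z.

(* Indices are 0-based: h j involves the coordinates j, ..., n-1. *)
Definition triangular_resolution (R : realType) (n k : nat) (hkn : (k <= n)%N)
    (Gamma : 'rV[R[i]]_n -> 'rV[R[i]]_n) (I : 'I_k -> set (cfun R n))
    (mu : 'I_k -> nat) (h : 'I_k -> cfun R n) : Prop :=
  forall j : 'I_k,
    [/\ holo_germ (h j), depends_from j (h j), I j (h j \o Gamma) &
        ord_coord (widen_ord hkn j) (h j) (mu j)].

Definition weierstrass_poly (R : realType) (n : nat) (j : 'I_n)
    (h : cfun R n) : Prop :=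
  exists (m : nat) (a : 'I_m -> cfun R n),
    (forall l, [/\ holo_germ (a l), depends_from j.+1 (a l) & a l 0 = 0]) /\
    {near (0 : 'rV[R[i]]_n), forall z : 'rV[R[i]]_n,
      h z = z 0 j ^+ m + \sum_(l < m) a l z * z 0 j ^+ l}.

(* Main.v *)
(* Let J = (f_1,...,f_j, phi_{j+1},...,phi_n).  A basis e of O_n/J generates the
   module O_n/(f_1,...,f_j) over the convergent power series in
   phi_{j+1},...,phi_n, so that phi_j e = C(phi_{j+1},...,phi_n) e modulo
   (f_1,...,f_j) for some square matrix C of size mu_j.  By the determinant trick,
   h_j(w) = det(w_j - C(w_{j+1},...,w_n)) satisfies h_j o phi in (f_1,...,f_j).
   As C(0) is the matrix of the multiplication by phi_j on the local algebra O_n/J,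
   it is nilpotent, whence h_j(w_j,0) = w_j^mu_j: the order of h_j is mu_j, which
   is better than the required bound.

   That e generates is a division with estimates.  Some powers of the coordinates lie
   in J, so every power series g of l1-norm M on a fixed small polydisc can be
   written g = sum_i c_i e_i + sum_l a_l f_l + sum_m b_m phi_m with norms at most
   K M, where K does not depend on g.  Dividing the b_m again, and so on, gives the
   power series sum_t (sum_i c_{t,i} e_i + sum_l a_{t,l} f_l), which converges where
   the phi_m are small compared with 1/K. *)
Require Import Defs.
From HB Require Import structures.
From mathcomp Require Import all_boot all_order all_algebra finmap complex.
From mathcomp Require Import all_classical all_reals ereal topology normedtype.
From mathcomp Require Import perm sequences summability ring lra.

Set Implicit Arguments.
Unset Strict Implicit.
Unset Printing Implicit Defensive.

Import Order.TTheory GRing.Theory Num.Theory.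
Import numFieldNormedType.Exports ComplexField.Normc.

Local Open Scope classical_set_scope.
Local Open Scope ring_scope.

(** * Complex norm and cubes *)

Section Normc.
Variable R : realType.
Local Notation C := R[i].
Local Notation toC := (real_complex R).

Lemma norm_normc (z : C) : `|z| = toC (normc z).
Proof. by case: z. Qed.

Lemma normc_ge0 (z : C) : 0 <= normc z.
Proof. by case: z => a b; rewrite sqrtr_ge0. Qed.

Lemma ler_normcD (x y : C) : normc (x + y) <= normc x + normc y.
Proof. exact: (le_normcD x y). Qed.

Lemma normc_opp (x : C) : normc (- x) = normc x.
Proof. exact: normcN. Qed.

Lemma normc_gt0 (x : C) : x != 0 -> 0 < normc x.
Proof. by move=> x0; rewrite lt_def normc_ge0 andbT; apply: contra x0 => /eqP/eq0_normc ->. Qed.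

Lemma normcX (x : C) n : normc (x ^+ n) = normc x ^+ n.
Proof. by elim: n => [|n IH]; rewrite ?expr0 ?normc1 // !exprS normcM IH. Qed.

Lemma normc_real (r : R) : 0 <= r -> normc (toC r) = r.
Proof. by move=> r0; rewrite /= expr0n /= addr0 sqrtr_sqr ger0_norm. Qed.

Lemma normc_distC (x y : C) : normc (x - y) = normc (y - x).
Proof. by rewrite -normc_opp opprB. Qed.

Lemma normc_sum (I : Type) (s : seq I) (P : pred I) (u : I -> C) :
  normc (\sum_(i <- s | P i) u i) <= \sum_(i <- s | P i) normc (u i).
Proof.
apply: (big_ind2 (fun x y => normc x <= y)) => //; first by rewrite normc0.
by move=> x1 x2 y1 y2 h1 h2; apply: le_trans (ler_normcD _ _) (lerD h1 h2).
Qed.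

Lemma normc_prod (I : Type) (s : seq I) (P : pred I) (u : I -> C) :
  normc (\prod_(i <- s | P i) u i) = \prod_(i <- s | P i) normc (u i).
Proof. by apply: (big_morph (@normc R) (@normcM R) (normc1 R)). Qed.

Lemma normc_ge_normRe (x : C) : `|complex.Re x| <= normc x.
Proof. by rewrite -lecR -norm_normc; exact: normc_ge_Re. Qed.

Lemma normc_ge_normIm (x : C) : `|complex.Im x| <= normc x.
Proof.
have := normc_ge_normRe (x * 'i%C).
by rewrite ReiNIm normrN normcM /= expr0n expr1n add0r sqrtr1 mulr1.
Qed.

Lemma normc_le_ReIm (x : C) : normc x <= `|complex.Re x| + `|complex.Im x|.
Proof.
case: x => a b /=.
have -> : `|a| + `|b| = Num.sqrt ((`|a| + `|b|) ^+ 2).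
  by rewrite sqrtr_sqr; apply/esym/ger0_norm/addr_ge0; apply: normr_ge0.
apply: ler_wsqrtr; rewrite sqrrD !real_normK ?num_real //.
have := mulr_ge0 (normr_ge0 a) (normr_ge0 b); lra.
Qed.

(** The order of [R[i]] makes positive elements real. Balls of [R[i]] have their radii there, and
    this turns those radii into elements of [R]. *)
Lemma gt0_complex (e : C) : 0 < e -> exists2 r : R, 0 < r & e = toC r.
Proof.
case: e => a b; rewrite ltcE /= => /andP[/eqP-> a0].
by exists a.
Qed.

Definition cube n (r : R) (z : 'rV[C]_n) := forall i, normc (z 0 i) <= r.

Lemma near_cubeP n (w : 'rV[C]_n) (P : 'rV[C]_n -> Prop) :
  (\forall z \near w, P z) <->
  exists2 r : R, 0 < r & forall z, cube r (z - w) -> P z.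
Proof.
split.
  move=> /nbhs_ballP [e /= e0 H].
  have [r r0 er] := gt0_complex e0.
  (* Cubes are closed and balls are open, so the radius is halved. *)
  exists (r / 2) => [|z zr]; first by rewrite divr_gt0.
  apply: H; split => // i j; have := zr j.
  rewrite /ball /= !mxE distrC norm_normc er ltcR ord1 => /le_lt_trans; apply.
  by rewrite ltr_pdivrMr // ltr_pMr // ltr1n.
move=> [r r0 H]; apply/nbhs_ballP; exists (toC r); first by rewrite /= (ltcR 0).
move=> z [_ zr]; apply: H => i; have := zr 0 i.
by rewrite /ball /= !mxE distrC norm_normc ltcR => /ltW.
Qed.

(** Unconditional convergence with a real [e] and the real-valued [normc], so that every estimate
    takes place in [R]. *)
Definition has_sum (I : choiceType) (u : I -> C) (s : C) :=
  forall e : R, 0 < e -> exists F0 : {fset I}, forall F : {fset I}, (F0 `<=` F)%fset ->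
    normc (\sum_(i <- F) u i - s) <= e.

Lemma partial_sumE (I : choiceType) (u : I -> C) (F : {fset I}) :
  partial_sum u F = \sum_(i <- F) u i.
Proof. by rewrite /partial_sum big_seq_fsetE. Qed.

Lemma has_sumP (I : choiceType) (u : I -> C) (s : C) :
  (partial_sum u @ totally --> s) <-> has_sum u s.
Proof.
split.
  move=> /(@cvgrPdist_le _ _ _ _ (totally_filter)) H e e0.
  have /H [F0 _ HF] : 0 < toC e by rewrite (ltcR 0).
  exists F0 => F /HF /=; rewrite distrC norm_normc partial_sumE.
  by rewrite lecR.
move=> H; apply/(@cvgrPdist_le _ _ _ _ (totally_filter)) => e /gt0_complex [r r0 ->].
have [F0 HF] := H _ r0.
exists F0 => // F /HF /=; by rewrite distrC norm_normc partial_sumE lecR.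
Qed.

End Normc.

(** * Unconditional sums *)

Section Sum.
Variable R : realType.
Local Notation C := R[i].
Local Notation toC := (real_complex R).
Local Open Scope fset_scope.
Local Open Scope ring_scope.

(** [M] is an upper bound of the l1-norm of [u]; in particular [u] is absolutely summable. *)
Definition abs_sum_le (I : choiceType) (u : I -> C) (M : R) :=
  forall F : {fset I}, \sum_(i <- F) normc (u i) <= M.

Variable I : choiceType.
Implicit Types (u v : I -> C) (F : {fset I}).

Lemma sum_subset (a : I -> R) F G : (forall i, 0 <= a i) -> F `<=` G ->
  \sum_(i <- F) a i <= \sum_(i <- G) a i.
Proof.
move=> a0 FG; rewrite (big_fsetID _ (mem F) G) /= (_ : [fset x | x in G & x \in F] = F).
  by rewrite lerDl sumr_ge0.
apply/fsetP => x; rewrite !inE /=; case xF : (x \in F); rewrite ?andbF //.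
by rewrite (fsubsetP FG _ xF).
Qed.

Lemma sum_fsetD (V : zmodType) (a : I -> V) F G : F `<=` G ->
  \sum_(i <- G) a i = \sum_(i <- F) a i + \sum_(i <- G `\` F) a i.
Proof.
move=> FG; rewrite (big_fsetID _ (mem F) G) /=; congr (_ + _).
  congr bigop; congr enum_fset.
  apply/fsetP => x; rewrite !inE /=; case xF : (x \in F); rewrite ?andbF //.
  by rewrite (fsubsetP FG _ xF).
congr bigop; congr enum_fset.
by apply/fsetP => x; rewrite !inE andbC.
Qed.

Lemma abs_sum_le_ge0 u M : abs_sum_le u M -> 0 <= M.
Proof. by move/(_ fset0); rewrite big_seq_fset0. Qed.

Lemma abs_sum_leW u M N : M <= N -> abs_sum_le u M -> abs_sum_le u N.
Proof. by move=> MN uM F; apply: le_trans MN. Qed.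

Lemma le_abs_sum_le u v M : (forall i, normc (v i) <= normc (u i)) ->
  abs_sum_le u M -> abs_sum_le v M.
Proof. by move=> vu uM F; apply: le_trans (uM F); apply: ler_sum. Qed.

Lemma abs_sum_leZ c u M : abs_sum_le u M -> abs_sum_le (fun i => c * u i) (normc c * M).
Proof.
move=> uM F; under eq_bigr do rewrite normcM.
by rewrite -mulr_sumr ler_wpM2l ?normc_ge0.
Qed.

Lemma abs_sum_leD u v M N : abs_sum_le u M -> abs_sum_le v N ->
  abs_sum_le (fun i => u i + v i) (M + N).
Proof.
move=> uM vN F; apply: le_trans (lerD (uM F) (vN F)).
by rewrite -big_split; apply: ler_sum => i _; apply: ler_normcD.
Qed.

(** Take [F0] whose sum is within [e] of the supremum of all finite sums: a set disjoint from [F0]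
    can add at most [e] to it. *)
Lemma abs_sum_le_tail u M e : abs_sum_le u M -> 0 < e ->
  exists F0, forall F, [disjoint F & F0] -> \sum_(i <- F) normc (u i) <= e.
Proof.
move=> uM e0; pose S : set R := [set x | exists F, x = \sum_(i <- F) normc (u i)].
have supS : has_sup S.
  split; first by exists (\sum_(i <- fset0) normc (u i)); exists fset0.
  by exists M => _ [F ->].
have [_ [F0 ->] hF0] := sup_adherent e0 supS.
exists F0 => F dF.
have hU : \sum_(i <- (F `|` F0)) normc (u i) <= sup S.
  by apply: ub_le_sup; [exact: supS.2 | exists (F `|` F0)].
rewrite (@sum_fsetD _ _ F0) ?fsubsetUr // in hU.
rewrite fsetDUl fsetDv fsetU0 in hU.
move: hU; have -> : F `\` F0 = F by apply/fsetDidPl.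
lra.
Qed.

Lemma has_sum_unique u s t : has_sum u s -> has_sum u t -> s = t.
Proof.
move=> hu ht; apply/eqP; rewrite -subr_eq0; apply/negPn/negP => /normc_gt0 d0.
have [|F1 h1] := hu (normc (s - t) / 3); first by rewrite divr_gt0.
have [|F2 h2] := ht (normc (s - t) / 3); first by rewrite divr_gt0.
have {}h1 := h1 _ (fsubsetUl F1 F2); have {}h2 := h2 _ (fsubsetUr F1 F2).
set x := \sum_(i <- _) _ in h1 h2.
have : normc (s - t) <= normc (s - x) + normc (x - t).
  by apply: le_trans (ler_normcD _ _); rewrite addrA subrK.
by rewrite (normc_distC s x); lra.
Qed.

Lemma eq_has_sum u v s : u =1 v -> has_sum u s -> has_sum v s.
Proof. by move/funext => ->. Qed.

Lemma has_sumD u v s t : has_sum u s -> has_sum v t -> has_sum (fun i => u i + v i) (s + t).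
Proof.
move=> hu hv e e0.
have [|F1 h1] := hu (e / 2); first by rewrite divr_gt0.
have [|F2 h2] := hv (e / 2); first by rewrite divr_gt0.
exists (F1 `|` F2) => F; rewrite fsubUset => /andP[/h1 {}h1 /h2 {}h2].
rewrite big_split /= opprD addrACA; apply: le_trans (ler_normcD _ _) _.
by rewrite [X in _ <= X]splitr; apply: lerD.
Qed.

Lemma has_sumZ c u s : has_sum u s -> has_sum (fun i => c * u i) (c * s).
Proof.
move=> hu e e0.
have c0 : 0 < normc c + 1 by rewrite ltr_wpDl ?normc_ge0.
have [|F1 h1] := hu (e / (normc c + 1)); first by rewrite divr_gt0.
exists F1 => F /h1 {}h1; rewrite -mulr_sumr -mulrBr normcM.
apply: (@le_trans _ _ ((normc c + 1) * (e / (normc c + 1)))).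
  apply: ler_pM => //; rewrite ?normc_ge0 //; lra.
by rewrite mulrC divfK // gt_eqF.
Qed.

Lemma has_sum0 : has_sum (fun _ : I => 0 : C) 0.
Proof.
by move=> e e0; exists fset0 => F _; rewrite big1 // subrr normc0 ltW.
Qed.

Lemma has_sum_single u i0 : (forall i, i != i0 -> u i = 0) -> has_sum u (u i0).
Proof.
move=> u0 e e0; exists [fset i0] => F; rewrite fsub1set => hF.
rewrite (big_fsetD1 i0) //= big1_fset ?addr0 ?subrr ?normc0 ?ltW // => i.
by rewrite !inE => /andP[/u0].
Qed.

Lemma has_sum_sum (T : Type) (s : seq T) (u : T -> I -> C) (a : T -> C) :
  (forall t, has_sum (u t) (a t)) -> has_sum (fun i => \sum_(t <- s) u t i) (\sum_(t <- s) a t).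
Proof.
move=> h; elim: s => [|t s IH].
  by rewrite big_nil; apply: eq_has_sum has_sum0 => i; rewrite big_nil.
by rewrite big_cons; apply: eq_has_sum (has_sumD (h t) IH) => i; rewrite big_cons.
Qed.

Lemma has_sum_norm_le u s M : abs_sum_le u M -> has_sum u s -> normc s <= M.
Proof.
move=> uM hu; apply/ler_addgt0Pr => e e0.
have [F h] := hu e e0; have {}h := h _ (fsubset_refl F).
have : normc s <= normc (s - \sum_(i <- F) u i) + normc (\sum_(i <- F) u i).
  by apply: le_trans (ler_normcD _ _); rewrite subrK.
rewrite normc_distC; have := le_trans (normc_sum F xpredT u) (uM F); lra.
Qed.

Lemma has_sum_nneg (a : I -> R) M : (forall i, 0 <= a i) -> abs_sum_le (toC \o a) M ->
  exists s, has_sum (toC \o a) s.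
Proof.
move=> a0 aM; pose S : set R := [set x | exists F, x = \sum_(i <- F) a i].
have eS F : \sum_(i <- F) normc ((toC \o a) i) = \sum_(i <- F) a i.
  by apply: eq_bigr => i _; rewrite normc_real.
have supS : has_sup S.
  split; first by exists (\sum_(i <- fset0) a i); exists fset0.
  by exists M => _ [F ->]; rewrite -eS.
exists (toC (sup S)) => e e0.
have [_ [F0 ->] hF0] := sup_adherent e0 supS.
exists F0 => F FF0.
rewrite normc_distC -(rmorph_sum (real_complex R)) -(rmorphB (real_complex R)).
have hU : \sum_(i <- F) a i <= sup S by apply: ub_le_sup; [exact: supS.2 | exists F].
rewrite normc_real ?subr_ge0 //.
have := sum_subset a0 FF0; lra.
Qed.

Lemma has_sum_exists u M : abs_sum_le u M -> exists s, has_sum u s.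
Proof.
move=> uM.
(* The real and imaginary parts are split into positive and negative parts, and each of the four
   nonnegative families has its supremum as sum. *)
pose p (x : R) := Num.max x 0.
have pn x : x = p x - p (- x) by rewrite /p /Num.max; case: ifP; case: ifP; lra.
have p0 x : 0 <= p x by rewrite /p le_max lexx orbT.
have pl x : p x <= `|x| by rewrite /p ge_max normr_ge0 ler_norm.
have key (w : I -> R) : (forall i, `|w i| <= normc (u i)) -> exists s, has_sum (toC \o p \o w) s.
  move=> hw; apply: (@has_sum_nneg (p \o w) M) => [i|]; first exact: p0.
  apply: le_abs_sum_le uM => i /=; rewrite -[X in X <= _]/(normc (toC (p (w i)))).
  by rewrite normc_real ?p0 //; apply: le_trans (hw i).
have [s1 h1] := key (fun i => complex.Re (u i)) (fun i => normc_ge_normRe _).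
have [s2 h2] : exists s, has_sum (toC \o p \o (fun i => - complex.Re (u i))) s.
  by apply: key => i; rewrite normrN normc_ge_normRe.
have [s3 h3] := key (fun i => complex.Im (u i)) (fun i => normc_ge_normIm _).
have [s4 h4] : exists s, has_sum (toC \o p \o (fun i => - complex.Im (u i))) s.
  by apply: key => i; rewrite normrN normc_ge_normIm.
have hre := has_sumD h1 (has_sumZ (-1) h2).
have him := has_sumZ 'i%C (has_sumD h3 (has_sumZ (-1) h4)).
exists (s1 + -1 * s2 + 'i%C * (s3 + -1 * s4)).
have pC x : toC (p x) + -1 * toC (p (- x)) = toC x.
  by rewrite mulN1r -(rmorphB (real_complex R)) -pn.
by apply: eq_has_sum (has_sumD hre him) => i; rewrite /comp !pC -complexE.
Qed.

(** In C, unconditional convergence is absolute. Finite sums away from [F0] have norm at most 2;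
    keeping only the indices where the real (or imaginary) part has a given sign removes all
    cancellation. Two signs and two parts give 8, to which [F0] itself is added. *)
Lemma abs_sum_le_exists u s : has_sum u s -> exists M, abs_sum_le u M.
Proof.
move=> hu; have [F0 hF0] := hu 1 ltr01.
have B F : [disjoint F & F0] -> normc (\sum_(i <- F) u i) <= 2.
  move=> dF; have h1 := hF0 F0 (fsubset_refl _); have h2 := hF0 _ (fsubsetUr F F0).
  rewrite (@sum_fsetD _ _ F0) ?fsubsetUr // fsetDUl fsetDv fsetU0 in h2.
  have E : F `\` F0 = F by apply/fsetDidPl.
  rewrite E in h2.
  set x := \sum_(i <- F) _ in h2 *; set y := \sum_(i <- F0) _ in h1 h2.
  have -> : x = (y + x - s) + - (y - s) by ring.
  by apply: le_trans (ler_normcD _ _) _; rewrite normc_opp; lra.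
have key (w : C -> R) : (forall x, w x <= normc x) -> {morph w : x y / x + y} -> w 0 = 0 ->
    forall F, [disjoint F & F0] -> \sum_(i <- F | 0 <= w (u i)) w (u i) <= 2.
  move=> hw wD w0 F dF.
  rewrite -(big_morph w wD w0) big_fset_condE.
  apply: le_trans (hw _) _; apply: B.
  by apply: fdisjointWl dF; apply: fset_sub.
have key2 (w : C -> R) : (forall x, `|w x| <= normc x) -> {morph w : x y / x + y} -> w 0 = 0 ->
    forall F, [disjoint F & F0] -> \sum_(i <- F) `|w (u i)| <= 4.
  move=> hw wD w0 F dF.
  rewrite (bigID (fun i => 0 <= w (u i))) /=.
  have h1 := key w (fun x => le_trans (ler_norm _) (hw x)) wD w0 F dF.
  have h2 : \sum_(i <- F | 0 <= - w (u i)) - w (u i) <= 2.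
    apply: (key (fun x => - w x)) => //; rewrite ?w0 ?oppr0 //.
      by move=> x; apply: le_trans (hw x); rewrite -normrN ler_norm.
    by move=> x y; rewrite wD opprD.
  have E1 : \sum_(i <- F | 0 <= w (u i)) `|w (u i)| = \sum_(i <- F | 0 <= w (u i)) w (u i).
    by apply: eq_bigr => i ?; rewrite ger0_norm.
  have E2 : \sum_(i <- F | ~~ (0 <= w (u i))) `|w (u i)| <=
        \sum_(i <- F | 0 <= - w (u i)) - w (u i).
    rewrite big_mkcond [X in _ <= X]big_mkcond; apply: ler_sum => i _.
    rewrite oppr_ge0; case: (leP 0 (w (u i))) => /= h.
      by case: ifP => // h'; lra.
    by rewrite (ltW h) ltr0_norm.
  lra.
exists (8 + \sum_(i <- F0) normc (u i)) => F.
apply: le_trans (sum_subset (fun i => normc_ge0 (u i)) (fsubsetUl F F0)) _.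
rewrite (@sum_fsetD _ _ F0) ?fsubsetUr // addrC lerD2r.
have dF : [disjoint (F `|` F0) `\` F0 & F0] by apply/fdisjointP => x; rewrite inE => /andP[].
have h1 : \sum_(i <- (F `|` F0) `\` F0) `|complex.Re (u i)| <= 4.
  apply: (key2 (fun x => complex.Re x)) => //; [exact: normc_ge_normRe|].
  by move=> [? ?] [? ?].
have h2 : \sum_(i <- (F `|` F0) `\` F0) `|complex.Im (u i)| <= 4.
  apply: (key2 (fun x => complex.Im x)) => //; [exact: normc_ge_normIm|].
  by move=> [? ?] [? ?].
apply: (@le_trans _ _ (\sum_(i <- (F `|` F0) `\` F0) (`|complex.Re (u i)| + `|complex.Im (u i)|))).
  by apply: ler_sum => i _; apply: normc_le_ReIm.
rewrite big_split /=; lra.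
Qed.
End Sum.

(** * Regrouping of absolutely convergent sums: partitions, products, series *)

Section Fubini.
Variable R : realType.
Local Notation C := R[i].
Local Notation toC := (real_complex R).
Local Open Scope fset_scope.
Local Open Scope ring_scope.

(** The phases [th k] satisfy [th k * v k = |v k|], so a finite sum of the [|v k|] is itself the sum
    of a family dominated termwise by [u]. When [v k = 0] the division gives [th k = 0], which is
    harmless. *)
Lemma abs_sum_le_partition (I K : choiceType) (p : I -> K) (u : I -> C) M (v : K -> C) :
  abs_sum_le u M -> (forall k, has_sum (fun i => if p i == k then u i else 0) (v k)) ->
  abs_sum_le v M.
Proof.
move=> uM hv G; pose th k := toC (normc (v k)) / v k.
have thv k : normc (v k) = normc (th k * v k).
  rewrite /th; case: (eqVneq (v k) 0) => [->|v0]; first by rewrite mulr0.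
  by rewrite divfK // normc_real // normc_ge0.
have th1 k : normc (th k) <= 1.
  rewrite /th; case: (eqVneq (v k) 0) => [->|v0]; first by rewrite invr0 mulr0 normc0.
  by rewrite normcM normcV normc_real ?normc_ge0 // mulfV // gt_eqF // normc_gt0.
have thE k : th k * v k = toC (normc (v k)).
  rewrite /th; case: (eqVneq (v k) 0) => [->|v0]; first by rewrite mulr0 normc0.
  by rewrite divfK.
have hG := has_sum_sum G (fun k => has_sumZ (th k) (hv k)).
have E : \sum_(k <- G) th k * v k = toC (\sum_(k <- G) normc (v k)).
  by rewrite rmorph_sum; apply: eq_bigr => k _; rewrite thE.
rewrite E in hG.
rewrite -[X in X <= _]normc_real; last by apply: sumr_ge0 => k _; apply: normc_ge0.
apply: has_sum_norm_le hG; apply: le_abs_sum_le uM => i.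
have [iG|iG] := boolP (p i \in G).
  rewrite (big_fsetD1 (p i)) //= eqxx big1_fset ?addr0 => [|k].
    by rewrite normcM -[leRHS]mul1r; apply: ler_wpM2r; rewrite ?normc_ge0.
  by rewrite !inE eq_sym => /andP[/negbTE->]; rewrite mulr0.
rewrite big1_fset ?normc0 ?normc_ge0 // => k kG _.
by case: eqP => [e|]; [rewrite e kG in iG | rewrite mulr0].
Qed.

Lemma has_sum_partition (I K : choiceType) (p : I -> K) (u : I -> C) M (v : K -> C) s :
  abs_sum_le u M -> (forall k, has_sum (fun i => if p i == k then u i else 0) (v k)) ->
  has_sum u s -> has_sum v s.
Proof.
move=> uM hv hu e e0; have [F0 hF0] := abs_sum_le_tail uM e0.
exists [fset p i | i in F0] => G F0G.
(* The error is the sum of a family that is 0 where [p i] lies in [G] and [- u i] elsewhere. As [G]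
   contains the image of [F0], this family lives off [F0], and the tail estimate bounds it. *)
have hG := has_sumD (has_sum_sum G hv) (has_sumZ (-1) hu).
rewrite -mulN1r; apply: has_sum_norm_le hG => F.
have E i : \sum_(k <- G) (if p i == k then u i else 0) = if p i \in G then u i else 0.
  have [iG|iG] := ifPn.
    rewrite (big_fsetD1 (p i)) //= eqxx big1_fset ?addr0 // => k.
    by rewrite !inE eq_sym => /andP[/negbTE->].
  rewrite big1_fset // => k kG _.
  by case: eqP => // e'; rewrite e' kG in iG.
under eq_bigr do rewrite E.
rewrite (big_fsetID _ (mem F0)) /= [X in X + _]big1_fset => [|i]; last first.
  rewrite !inE => /andP[_ iF0] _; rewrite (fsubsetP F0G) ?in_imfset //.
  by rewrite mulN1r subrr normc0.
rewrite add0r; apply: (@le_trans _ _ (\sum_(i <- [fset x in F | x \notin F0]) normc (u i))).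
  apply: ler_sum => i _; case: ifP => _; last by rewrite add0r mulN1r normc_opp.
  by rewrite mulN1r subrr normc0 normc_ge0.
by apply: hF0; apply/fdisjointP => x; rewrite !inE => /andP[].
Qed.

Lemma sum_slice (V : nmodType) (I J : choiceType) (F : {fset I * J}) (w : I * J -> V) i :
  \sum_(x <- F | x.1 == i) w x =
  \sum_(j <- [fset x.2 | x in [fset y in F | y.1 == i]]) w (i, j).
Proof.
rewrite big_imfset /=.
  rewrite big_fset_condE; apply: eq_big_seq => -[a b].
  by rewrite !inE /= => /andP[_ /eqP->].
by move=> [a b] [a' b']; rewrite !inE /= => /andP[_ /eqP->] /andP[_ /eqP->] ->.
Qed.

Lemma has_sum_slice (I J : choiceType) (u : I * J -> C) i s :
  has_sum (fun j => u (i, j)) s -> has_sum (fun x => if x.1 == i then u x else 0) s.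
Proof.
move=> hu e /hu [F0 hF0].
exists [fset (i, j) | j in F0] => F /fsubsetP F0F.
rewrite -big_mkcond sum_slice; apply: hF0.
apply/fsubsetP => j jF0; apply/imfsetP; exists (i, j) => //=.
by rewrite !inE eqxx andbT; apply: F0F; apply: in_imfset.
Qed.

Lemma abs_sum_le_prod (I J : choiceType) (u : I * J -> C) (m : I -> R) M :
  (forall i, abs_sum_le (fun j => u (i, j)) (m i)) ->
  (forall F : {fset I}, \sum_(i <- F) m i <= M) -> abs_sum_le u M.
Proof.
move=> um mM F; rewrite (partition_big_imfset _ fst) /=.
apply: le_trans (mM _); apply: ler_sum => i _.
by rewrite sum_slice; apply: um.
Qed.

(** Absolute summability gives [u] some sum; partitioning along the first projection shows that the
    slice sums add up to it, so it is [s]. *)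
Lemma has_sum_fubini (I J : choiceType) (u : I * J -> C) M (v : I -> C) s :
  abs_sum_le u M -> (forall i, has_sum (fun j => u (i, j)) (v i)) -> has_sum v s -> has_sum u s.
Proof.
move=> uM uv vs; have [t ut] := has_sum_exists uM.
suff -> : s = t by [].
exact: has_sum_unique vs (has_sum_partition (p := fst) uM (fun i => has_sum_slice (uv i)) ut).
Qed.

(** The value is 0 when there is no sum. *)
Definition tsum (I : choiceType) (u : I -> C) : C := xget 0 [set s | has_sum u s].

Lemma has_sum_tsum (I : choiceType) (u : I -> C) M : abs_sum_le u M -> has_sum u (tsum u).
Proof. by move=> /has_sum_exists [s us]; apply: (xgetPex 0); exists s. Qed.

Lemma tsumE (I : choiceType) (u : I -> C) s : has_sum u s -> tsum u = s.
Proof.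
move=> us; suff h : has_sum u (tsum u) by exact: has_sum_unique h us.
by apply: (xgetPex 0); exists s.
Qed.

Lemma fset_nat_bound (F : {fset nat}) :
  exists T, forall T', (T <= T')%N -> F `<=` seq_fset tt (iota 0 T').
Proof.
exists (\max_(i <- enum_fset F) i).+1 => T' hT'.
apply/fsubsetP => x xF; rewrite seq_fsetE mem_iota /= add0n; apply: leq_trans hT'.
exact: (@leq_bigmax_seq nat (enum_fset F) xpredT id x xF).
Qed.

Lemma sum_fset_iota (V : nmodType) (u : nat -> V) T :
  \sum_(k <- seq_fset tt (iota 0 T)) u k = \sum_(t < T) u t.
Proof.
rewrite -(big_mkord xpredT u) /index_iota subn0; apply: perm_big.
by apply: uniq_perm; rewrite ?fset_uniq ?iota_uniq // => x; rewrite seq_fsetE.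
Qed.

(** For an absolutely summable sequence, the limit of the initial partial sums is the unconditional
    sum, because initial segments eventually contain any finite set. *)
Lemma has_sum_series (u : nat -> C) (M : R) (s : C) : abs_sum_le u M ->
  (forall e : R, 0 < e -> exists T0, forall T, (T0 <= T)%N ->
     normc (\sum_(t < T) u t - s) <= e) -> has_sum u s.
Proof.
move=> uM h; have [s' us'] := has_sum_exists uM.
suff -> : s = s' by [].
apply/eqP; rewrite -subr_eq0; apply/negPn/negP => /normc_gt0 d0.
have [|F1 h1] := us' (normc (s - s') / 3); first by rewrite divr_gt0.
have [|T0 h2] := h (normc (s - s') / 3); first by rewrite divr_gt0.
have [T1 hT1] := fset_nat_bound F1; pose T := maxn T0 T1.
have {}h2 := h2 T (leq_maxl _ _).
have {}h1 := h1 _ (hT1 T (leq_maxr _ _)); rewrite sum_fset_iota in h1.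
set x := \sum_(t < T) _ in h1 h2.
have : normc (s - s') <= normc (s - x) + normc (x - s').
  by apply: le_trans (ler_normcD _ _); rewrite addrA subrK.
by rewrite (normc_distC s x); lra.
Qed.

End Fubini.

(** * Absolutely convergent power series *)

Section Wiener.
Variable R : realType.
Local Notation C := R[i].
Local Notation toC := (real_complex R).

Notation mindex n := {ffun 'I_n -> nat}.
Definition deg n (al : mindex n) := (\sum_(i < n) al i)%N.
Definition mono n (al : mindex n) (z : 'rV[C]_n) : C := \prod_(i < n) z 0 i ^+ al i.

(* The least such M is the norm of f in the Banach algebra of the absolutely convergent
   power series on the closed polydisc of radius r. *)
Definition absconv n (r : R) (f : cfun R n) (M : R) :=
  exists a : mindex n -> C,
    abs_sum_le (fun al => a al * toC r ^+ deg al) M /\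
    forall z, cube r z -> has_sum (fun al => a al * mono al z) (f z).

Lemma cubeW n r s (z : 'rV[C]_n) : r <= s -> cube r z -> cube s z.
Proof. by move=> rs h i; apply: le_trans rs. Qed.

Lemma cube0 n r : 0 <= r -> cube r (0 : 'rV[C]_n).
Proof. by move=> r0 i; rewrite mxE normc0. Qed.

Lemma normc_realX r k : 0 <= r -> normc (toC r ^+ k) = r ^+ k.
Proof. by move=> r0; rewrite normcX normc_real. Qed.

Lemma normc_mono n (al : mindex n) (z : 'rV[C]_n) r : cube r z -> normc (mono al z) <= r ^+ deg al.
Proof.
move=> zr; rewrite /mono normc_prod /deg -prodrXr.
by apply: ler_prod => i _; rewrite normc_ge0 normcX lerXn2r ?nnegrE ?normc_ge0 //
  (le_trans (normc_ge0 _) (zr i)).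
Qed.

Lemma mono0 n (z : 'rV[C]_n) : mono [ffun=> 0%N] z = 1.
Proof. by rewrite /mono big1 // => i _; rewrite ffunE. Qed.

Lemma deg0 n : deg ([ffun=> 0%N] : mindex n) = 0%N.
Proof. by rewrite /deg big1 // => i _; rewrite ffunE. Qed.

Definition midx_add n (al be : mindex n) : mindex n := [ffun i => (al i + be i)%N].

Lemma monoD n (al be : mindex n) z : mono (midx_add al be) z = mono al z * mono be z.
Proof. by rewrite /mono -big_split; apply: eq_bigr => i _; rewrite ffunE exprD. Qed.

Lemma degD n (al be : mindex n) : deg (midx_add al be) = (deg al + deg be)%N.
Proof. by rewrite /deg -big_split; apply: eq_bigr => i _; rewrite ffunE. Qed.

Definition midx_nat n (i : 'I_n) (k : nat) : mindex n := [ffun j => if j == i then k else 0%N].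

Lemma mono_nat n (i : 'I_n) k z : mono (midx_nat i k) z = z 0 i ^+ k.
Proof.
rewrite /mono (bigD1 i) //= ffunE eqxx big1 ?mulr1 // => j /negbTE ji.
by rewrite ffunE ji.
Qed.

Lemma deg_nat n (i : 'I_n) k : deg (midx_nat i k) = k.
Proof.
rewrite /deg (bigD1 i) //= ffunE eqxx big1 ?addn0 // => j /negbTE ji.
by rewrite ffunE ji.
Qed.

Section Fixed.
Variables (n : nat) (r : R).
Hypothesis r0 : 0 < r.
Implicit Types (f g : cfun R n) (z : 'rV[C]_n).

Lemma abs_sum_le_mono (I : choiceType) (c : I -> C) (be : I -> mindex n) M z :
  abs_sum_le (fun i => c i * toC r ^+ deg (be i)) M -> cube r z ->
  abs_sum_le (fun i => c i * mono (be i) z) M.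
Proof.
move=> cM zr; apply: le_abs_sum_le cM => i; rewrite !normcM normc_realX ?(ltW r0) //.
by apply: ler_wpM2l; [apply: normc_ge0 | apply: normc_mono].
Qed.

(* be need not be injective: products and infinite sums of power series have this form. *)
Lemma absconv_gen (I : choiceType) (c : I -> C) (be : I -> mindex n) f M :
  abs_sum_le (fun i => c i * toC r ^+ deg (be i)) M ->
  (forall z, cube r z -> has_sum (fun i => c i * mono (be i) z) (f z)) ->
  absconv r f M.
Proof.
move=> cM hf.
(* The weight [r ^ deg] stays in [u], so that the sum over each fibre is bounded by [M]; it is
   divided out afterwards, which gives the coefficient at [b]. *)
pose u b i := if be i == b then c i * toC r ^+ deg (be i) else 0.
have uM b : abs_sum_le (u b) M.
  apply: le_abs_sum_le cM => i; rewrite /u; case: ifP => // _; rewrite normc0; exact: normc_ge0.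
have rC k : toC r ^+ k != 0 by rewrite expf_neq0 // fmorph_eq0 gt_eqF.
exists (fun b => tsum (u b) / toC r ^+ deg b); split.
  rewrite (_ : (fun _ => _) = fun b => tsum (u b)).
    by apply: (abs_sum_le_partition (p := be) cM) => b; apply: has_sum_tsum (uM b).
  by apply/funext => b; rewrite divfK.
move=> z zr; apply: (has_sum_partition (p := be) (abs_sum_le_mono cM zr) _ (hf z zr)) => b.
have := has_sumZ ((toC r ^+ deg b)^-1 * mono b z) (has_sum_tsum (uM b)).
rewrite [X in has_sum _ X -> _](_ : _ = tsum (u b) / toC r ^+ deg b * mono b z); last by ring.
apply: eq_has_sum => i; rewrite /u; case: eqP => [<-|]; last by rewrite mulr0.
move: (rC (deg (be i))); move: (toC r ^+ _) => T T0; by field.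
Qed.

Lemma absconv_eq f g M : (forall z, cube r z -> f z = g z) ->
  absconv r f M -> absconv r g M.
Proof. by move=> fg [a [aM ha]]; exists a; split => // z zr; rewrite -fg //; apply: ha. Qed.

Lemma absconvW f M N : M <= N -> absconv r f M -> absconv r f N.
Proof. by move=> MN [a [aM ha]]; exists a; split => //; apply: abs_sum_leW aM. Qed.

Lemma absconv_ge0 f M : absconv r f M -> 0 <= M.
Proof. by move=> [a [/abs_sum_le_ge0]]. Qed.

Lemma absconv_le f M z : absconv r f M -> cube r z -> normc (f z) <= M.
Proof.
move=> [a [aM ha]] zr.
exact: has_sum_norm_le (abs_sum_le_mono (be := id) aM zr) (ha z zr).
Qed.

Lemma absconv_infsum (K : choiceType) (f : K -> cfun R n) (m : K -> R) g M :
  (forall k, absconv r (f k) (m k)) ->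
  (forall F : {fset K}, \sum_(k <- F) m k <= M) ->
  (forall z, cube r z -> has_sum (fun k => f k z) (g z)) ->
  absconv r g M.
Proof.
move=> /choice [a ha] mM hg.
have aM : abs_sum_le (fun x : K * mindex n => a x.1 x.2 * toC r ^+ deg x.2) M.
  by apply: abs_sum_le_prod mM => k; case: (ha k).
apply: (absconv_gen (I := (K * mindex n)%type) (be := snd) aM) => z zr.
apply: (has_sum_fubini (abs_sum_le_mono aM zr) _ (hg z zr)) => k.
by case: (ha k) => _; apply.
Qed.

Lemma absconv_mono (al : mindex n) (c : C) :
  absconv r (fun z => c * mono al z) (normc c * r ^+ deg al).
Proof.
apply: (absconv_gen (I := unit) (c := fun=> c) (be := fun=> al)).
  move=> F; rewrite -(normc_realX _ (ltW r0)) -normcM.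
  have : (F `<=` [fset tt])%fset by apply/fsubsetP => -[]; rewrite inE.
  rewrite fsubset1 => /orP[/eqP->|/eqP->]; first by rewrite big_seq_fset1.
  by rewrite big_seq_fset0 normc_ge0.
by move=> z _; apply: (has_sum_single (i0 := tt)) => -[].
Qed.

Lemma absconv_cst c : absconv r (fun _ : 'rV[C]_n => c) (normc c).
Proof.
have := absconv_mono [ffun=> 0%N] c; rewrite deg0 expr0 mulr1.
by apply: absconv_eq => z _; rewrite mono0 mulr1.
Qed.

Lemma absconv_coord i : absconv r (fun z : 'rV[C]_n => z 0 i) r.
Proof.
have := absconv_mono (midx_nat i 1) 1; rewrite deg_nat expr1 normc1 mul1r.
by apply: absconv_eq => z _; rewrite mono_nat mul1r.
Qed.

Lemma absconvD f g M N : absconv r f M -> absconv r g N ->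
  absconv r (fun z => f z + g z) (M + N).
Proof.
move=> [a [aM ha]] [b [bN hb]]; exists (fun al => a al + b al); split.
  by have := abs_sum_leD aM bN; congr abs_sum_le; apply/funext => al; rewrite mulrDl.
by move=> z zr; apply: eq_has_sum (has_sumD (ha z zr) (hb z zr)) => al; rewrite mulrDl.
Qed.

Lemma absconv_sum (T : Type) (s : seq T) (P : pred T) (f : T -> cfun R n) (m : T -> R) :
  (forall t, P t -> absconv r (f t) (m t)) ->
  absconv r (fun z => \sum_(t <- s | P t) f t z) (\sum_(t <- s | P t) m t).
Proof.
move=> h; elim: s => [|t s IH].
  have := absconv_cst 0; rewrite normc0 big_nil; apply: absconv_eq => z _.
  by rewrite big_nil.
rewrite big_cons; case: ifP => Pt.
  by apply: absconv_eq (absconvD (h _ Pt) IH) => z _; rewrite big_cons Pt.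
by apply: absconv_eq IH => z _; rewrite big_cons Pt.
Qed.

Lemma absconvM f g M N : absconv r f M -> absconv r g N ->
  absconv r (fun z => f z * g z) (M * N).
Proof.
move=> [a [aM ha]] [b [bN hb]].
pose c (x : mindex n * mindex n) := a x.1 * b x.2.
have cMN : abs_sum_le (fun x => c x * toC r ^+ deg (midx_add x.1 x.2)) (M * N).
  apply: (abs_sum_le_prod (m := fun i => normc (a i * toC r ^+ deg i) * N)) => [i F|F].
    apply: le_trans (abs_sum_leZ (a i * toC r ^+ deg i) bN F).
    by apply: ler_sum => j _; rewrite /c /= degD exprD mulrACA.
  by rewrite -mulr_suml; apply: ler_wpM2r => //; apply: abs_sum_le_ge0 bN.
apply: (absconv_gen (be := fun x => midx_add x.1 x.2) cMN) => z zr.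
apply: (has_sum_fubini (v := fun i => a i * mono i z * g z) (abs_sum_le_mono cMN zr)) => [i|].
  by apply: eq_has_sum (has_sumZ (a i * mono i z) (hb z zr)) => j; rewrite /c /= monoD mulrACA.
by rewrite mulrC; apply: eq_has_sum (has_sumZ (g z) (ha z zr)) => i; rewrite mulrC.
Qed.

Lemma absconvZ c f M : absconv r f M -> absconv r (fun z => c * f z) (normc c * M).
Proof. by move=> fM; apply: absconvM => //; apply: absconv_cst. Qed.

Lemma absconvX f M k : absconv r f M -> absconv r (fun z => f z ^+ k) (M ^+ k).
Proof.
move=> fM; elim: k => [|k IH].
  by have := absconv_cst 1; rewrite normc1 expr0; apply: absconv_eq => z _; rewrite expr0.
by rewrite exprS; apply: absconv_eq (absconvM fM IH) => z _; rewrite exprS.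
Qed.

Lemma absconv_prod (T : Type) (s : seq T) (f : T -> cfun R n) (m : T -> R) :
  (forall t, absconv r (f t) (m t)) ->
  absconv r (fun z => \prod_(t <- s) f t z) (\prod_(t <- s) m t).
Proof.
move=> h; elim: s => [|t s IH].
  have := absconv_cst 1; rewrite normc1 big_nil; apply: absconv_eq => z _.
  by rewrite big_nil.
rewrite big_cons; apply: absconv_eq (absconvM (h t) IH) => z _; by rewrite big_cons.
Qed.

Lemma absconv_shrink s f M : 0 < s -> s <= r -> absconv r f M -> absconv s f M.
Proof.
move=> s0 sr [a [aM ha]]; exists a; split.
  apply: le_abs_sum_le aM => al; rewrite !normcM !normc_realX ?(ltW r0) ?(ltW s0) //.
  by apply: ler_wpM2l; rewrite ?normc_ge0 // lerXn2r ?nnegrE ?(ltW r0) ?(ltW s0).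
by move=> z zs; apply: ha; apply: cubeW zs.
Qed.

(** By submultiplicativity, substituting functions of norm at most [rho] turns the monomial of index
    [al] into a function of norm at most [rho ^ deg al], which is exactly the weight in the norm of
    [c]. The functions [Phi i] may be nonzero at 0, which allows recentring a series. *)
Lemma absconv_comp m rho (c : cfun R m) (Phi : 'I_m -> cfun R n) M : 0 < rho ->
  absconv rho c M -> (forall i, absconv r (Phi i) rho) ->
  absconv r (fun z => c (\row_i Phi i z)) M.
Proof.
move=> rho0 [a [aM ha]] hPhi.
apply: (absconv_infsum (f := fun al z => a al * mono al (\row_i Phi i z))
  (m := fun al => normc (a al * toC rho ^+ deg al))) => // [al|z zr].
  rewrite normcM normc_realX ?(ltW rho0) //; apply: absconvZ; rewrite /deg -prodrXr.
  apply: absconv_eq (absconv_prod (index_enum _) (fun i => absconvX (al i) (hPhi i))).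
  by move=> z _; rewrite /mono; apply: eq_bigr => i _; rewrite mxE.
by apply: ha => i; rewrite mxE; apply: absconv_le (hPhi i) zr.
Qed.

(** The constant coefficient is [f 0 = 0], and every other term gains at least a factor [t / r] when
    the radius shrinks from [r] to [t]. *)
Lemma absconv_small f M e : absconv r f M -> f 0 = 0 -> 0 < e ->
  exists2 s, 0 < s & forall t, 0 < t -> t <= s -> absconv t f e.
Proof.
move=> fM f00 e0; have M0 := absconv_ge0 fM; case: fM => [a [aM ha]].
have a0 : a [ffun=> 0%N] = 0.
  have h := ha 0 (cube0 (ltW r0)); rewrite f00 in h.
  pose al0 : mindex n := [ffun=> 0%N].
  have h' : has_sum (fun al => a al * mono al 0) (a al0).
    rewrite -[a al0]mulr1 -(mono0 (0 : 'rV[C]_n)); apply: has_sum_single => al al0N; rewrite /mono.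
    have [i ali] : exists i, al i != 0%N.
      apply/existsP; rewrite -negb_forall; apply: contra al0N => /forallP h0.
      by apply/eqP/ffunP => i; rewrite ffunE; apply/eqP.
    by rewrite (bigD1 i) //= mxE expr0n (negbTE ali) mul0r mulr0.
  exact: has_sum_unique h' h.
have M1 : 0 < M + 1 by lra.
(* This makes [t / r * M] at most [e]; the denominator [M + 1] is positive even if [M = 0]. *)
exists (Num.min r (r * (e / (M + 1)))).
  by rewrite lt_min r0 mulr_gt0 // divr_gt0.
move=> t t0; rewrite le_min => /andP[tr te]; exists a; split; last first.
  by move=> z zs; apply: ha; apply: cubeW zs.
have key (F : {fset mindex n}) : \sum_(al <- F) normc (a al * toC t ^+ deg al) <= t / r * M.
  apply: le_trans (ler_wpM2l _ (aM F)); last by rewrite divr_ge0 ?ltW.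
  rewrite mulr_sumr; apply: ler_sum => al _; rewrite !normcM !normc_realX ?(ltW r0) ?(ltW t0) //.
  have [->|al0N] := eqVneq al [ffun=> 0%N]; first by rewrite a0 normc0 !mul0r mulr0.
  rewrite mulrCA; apply: ler_wpM2l; rewrite ?normc_ge0 //.
  have : (0 < deg al)%N.
    rewrite lt0n; apply: contra al0N => /eqP; rewrite /deg => /eqP.
    rewrite sum_nat_eq0 => /forallP h0; apply/eqP/ffunP => i; rewrite ffunE.
    by have := h0 i => /= /eqP.
  case: (deg al) => // k _; rewrite !exprS mulrA divfK ?gt_eqF //.
  by apply: ler_wpM2l; rewrite ?(ltW t0) // lerXn2r ?nnegrE ?(ltW r0) ?(ltW t0).
move=> F; apply: le_trans (key F) _.
have : t / r <= e / (M + 1) by rewrite ler_pdivrMr // mulrC.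
move=> h; apply: (@le_trans _ _ (e / (M + 1) * (M + 1))).
  apply: ler_pM => //; first by rewrite divr_ge0 ?ltW.
  by rewrite lerDl.
by rewrite divfK // gt_eqF.
Qed.
End Fixed.
End Wiener.

(** * Germs of holomorphic functions *)

Section Germs.
Variable R : realType.
Local Notation C := R[i].
Local Notation toC := (real_complex R).

Lemma geom_fset (q : R) (F : {fset nat}) : 0 <= q -> q < 1 ->
  \sum_(k <- F) q ^+ k <= (1 - q)^-1.
Proof.
move=> q0 q1; have q1' : 0 < 1 - q by rewrite subr_gt0.
have [T hT] := fset_nat_bound F.
apply: le_trans (sum_subset (fun k => exprn_ge0 k q0) (hT T (leqnn T))) _.
rewrite sum_fset_iota.
rewrite -[X in X <= _](mulfK (x := 1 - q)) ?gt_eqF // ler_pdivrMr // mulVf ?gt_eqF //.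
have -> : (\sum_(t < T) q ^+ t) * (1 - q) = 1 - q ^+ T.
  by rewrite -[RHS]opprB subrX1 -mulNr opprB mulrC.
by rewrite gerBl exprn_ge0.
Qed.

Lemma geom_small (q K e : R) : 0 <= q -> q < 1 -> 0 < e ->
  exists T0, forall T, (T0 <= T)%N -> K * q ^+ T <= e.
Proof.
move=> q0 q1 e0.
have : (fun t => K * q ^+ t) @ \oo --> K * 0.
  (* Only an upper bound is wanted, so [K] may have any sign. *)
  by apply: cvgM; [exact: cvg_cst | apply: cvg_expr; rewrite ger0_norm].
rewrite mulr0 => /cvgrPdist_le /(_ _ e0) [T0 _ h].
exists T0 => T /h /=; rewrite sub0r normrN; apply: le_trans; exact: ler_norm.
Qed.

Lemma has_sum_geom (x : C) (q : R) : normc x <= q -> q < 1 -> has_sum (fun k => x ^+ k) (1 - x)^-1.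
Proof.
move=> xq q1; have q0 := le_trans (normc_ge0 _) xq.
have x1 : 1 - x != 0.
  apply: contraTneq q1 => /eqP; rewrite subr_eq0 => /eqP e.
  by rewrite -leNgt -(normc1 R) e.
apply: (has_sum_series (M := (1 - q)^-1)) => [F|e e0].
  apply: le_trans (geom_fset F q0 q1); apply: ler_sum => k _.
  by rewrite normcX lerXn2r ?nnegrE ?normc_ge0.
have [T0 h] := geom_small (normc (1 - x)^-1) q0 q1 e0.
exists T0 => T /h; apply: le_trans.
have -> : \sum_(t < T) x ^+ t - (1 - x)^-1 = (1 - x)^-1 * - x ^+ T.
  have e1 : (\sum_(t < T) x ^+ t) * (1 - x) = 1 - x ^+ T.
    by rewrite -[RHS]opprB subrX1 -mulNr opprB mulrC.
  by rewrite -[\sum_(t < T) _](mulfK x1) e1; field.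
by rewrite normcM normc_opp normcX; apply: ler_wpM2l; rewrite ?normc_ge0 //
  lerXn2r ?nnegrE ?normc_ge0.
Qed.

(** Neighbourhoods of 0 become a filter on one real radius, so that finitely many conditions on the
    polydisc are met by a common small [r]. *)
Lemma near0P n (P : 'rV[C]_n -> Prop) :
  (\forall z \near (0 : 'rV[C]_n), P z) <->
  \forall r \near (0 : R)^'+, forall z, cube r z -> P z.
Proof.
rewrite near_cubeP; split => [[r r0 h]|h].
  near=> s => z zs; apply: h; rewrite subr0; apply: cubeW zs.
  by near: s; apply: nbhs_right_le.
have [r [r0 hr]] := (filter_ex (filterI (nbhs_right_gt (0 : R)) h)).
by exists r => // z; rewrite subr0; apply: hr.
Unshelve. all: end_near. Qed.

Variable n : nat.
Implicit Types (f g : cfun R n) (z w : 'rV[C]_n).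

(** At the point [(r, ..., r)] the terms of the series are [a al * r ^ deg al]; unconditional
    convergence there is absolute, which bounds the norm on the polydisc of radius [r]. *)
Lemma analytic_absconv f : analytic_at f 0 ->
  \forall r \near (0 : R)^'+, exists M, absconv r f M.
Proof.
move=> [a /near0P ha]; apply: filterS (filterI (nbhs_right_gt (0 : R)) ha) => r [r0 hr].
have hf z : cube r z -> has_sum (fun al => a al * mono al z) (f z).
  move=> zr; have /has_sumP := hr z zr; apply: eq_has_sum => // al.
  congr (_ * _); apply: eq_bigr => i _; by rewrite mxE subr0.
have [|M aM] := abs_sum_le_exists (hf (const_mx (toC r)) _).
  by move=> i; rewrite mxE normc_real // ltW.
exists M, a; split => //; move: aM; congr abs_sum_le; apply/funext => al; congr (_ * _).
by rewrite /mono /deg -prodrXr; apply: eq_bigr => i _; rewrite mxE.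
Qed.

(** Recentring at [w] is the composition of [f] with the functions [w_i + z_i], whose norm for the
    radius [r / 2] is at most [r / 2 + r / 2 = r]. *)
Lemma absconv_analytic (r : R) f (M : R) w :
  0 < r -> absconv r f M -> cube (r / 2) w -> analytic_at f w.
Proof.
move=> r0 fM wr; have r20 : 0 < r / 2 by rewrite divr_gt0.
have : absconv (r / 2) (fun z => f (w + z)) M.
  have := absconv_comp r20 r0 fM (Phi := fun i z => w 0 i + z 0 i) _.
  move=> H; apply: absconv_eq (H _) => [z _|i].
    by congr f; apply/rowP => i; rewrite !mxE.
  apply: (absconvW _ (absconvD (absconv_cst n r20 (w 0 i)) (absconv_coord r20 i))).
  by rewrite [leRHS]splitr lerD2r.
move=> [a [_ ha]]; exists a; apply/near_cubeP; exists (r / 2) => // z zr.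
apply/has_sumP; have := ha _ zr; rewrite [w + _]addrC subrK.
apply: eq_has_sum => al; congr (_ * _); apply: eq_bigr => i _; by rewrite !mxE.
Qed.

Lemma holo_germP f : holo_germ f <-> \forall r \near (0 : R)^'+, exists M, absconv r f M.
Proof.
split => [/nbhs_singleton/analytic_absconv //|h].
have [r [r0 [M fM]]] := filter_ex (filterI (nbhs_right_gt (0 : R)) h).
apply/near_cubeP; exists (r / 2); first by rewrite divr_gt0.
by move=> z; rewrite subr0; apply: absconv_analytic fM.
Qed.

Lemma absconv_holo (r : R) f (M : R) : 0 < r -> absconv r f M -> holo_germ f.
Proof.
move=> r0 fM; apply/near_cubeP; exists (r / 2); first by rewrite divr_gt0.
by move=> z; rewrite subr0; apply: absconv_analytic fM.
Qed.

Lemma holo_ext f g : f =1 g -> holo_germ f -> holo_germ g.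
Proof. by move/funext->. Qed.

Lemma holo_cst c : holo_germ (fun _ : 'rV[C]_n => c).
Proof. exact: absconv_holo ltr01 (absconv_cst n ltr01 c). Qed.

Lemma holo_coord i : holo_germ (fun z : 'rV[C]_n => z 0 i).
Proof. exact: absconv_holo ltr01 (absconv_coord ltr01 i). Qed.

Lemma holoD f g : holo_germ f -> holo_germ g -> holo_germ (fun z => f z + g z).
Proof.
move=> /holo_germP hf /holo_germP hg; apply/holo_germP.
apply: filterS2 (filterI (nbhs_right_gt (0 : R)) hf) hg => r [r0 [M fM]] [N gN].
by exists (M + N); apply: absconvD.
Qed.

Lemma holoM f g : holo_germ f -> holo_germ g -> holo_germ (fun z => f z * g z).
Proof.
move=> /holo_germP hf /holo_germP hg; apply/holo_germP.
apply: filterS2 (filterI (nbhs_right_gt (0 : R)) hf) hg => r [r0 [M fM]] [N gN].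
by exists (M * N); apply: absconvM.
Qed.

Lemma holoN f : holo_germ f -> holo_germ (fun z => - f z).
Proof.
move=> hf; apply: holo_ext (holoM (holo_cst (-1)) hf).
by move=> z; rewrite mulN1r.
Qed.

Lemma holo_sum (T : Type) (s : seq T) (P : pred T) (f : T -> cfun R n) :
  (forall t, P t -> holo_germ (f t)) -> holo_germ (fun z => \sum_(t <- s | P t) f t z).
Proof.
move=> h; elim: s => [|t s IH].
  by apply: holo_ext (holo_cst 0); move=> z; rewrite big_nil.
have [Pt|Pt] := boolP (P t).
  by apply: holo_ext (holoD (h _ Pt) IH); move=> z; rewrite big_cons Pt.
by apply: holo_ext IH; move=> z; rewrite big_cons (negbTE Pt).
Qed.

Lemma holo_prod (T : Type) (s : seq T) (P : pred T) (f : T -> cfun R n) :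
  (forall t, P t -> holo_germ (f t)) -> holo_germ (fun z => \prod_(t <- s | P t) f t z).
Proof.
move=> h; elim: s => [|t s IH].
  by apply: holo_ext (holo_cst 1); move=> z; rewrite big_nil.
have [Pt|Pt] := boolP (P t).
  by apply: holo_ext (holoM (h _ Pt) IH); move=> z; rewrite big_cons Pt.
by apply: holo_ext IH; move=> z; rewrite big_cons (negbTE Pt).
Qed.

Lemma holoX f k : holo_germ f -> holo_germ (fun z => f z ^+ k).
Proof.
move=> hf; elim: k => [|k IH].
  by apply: holo_ext (holo_cst 1); move=> z; rewrite expr0.
by apply: holo_ext (holoM hf IH); move=> z; rewrite exprS.
Qed.

Lemma near_absconv_small f : holo_germ f -> f 0 = 0 -> forall e, 0 < e ->
  \forall r \near (0 : R)^'+, absconv r f e.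
Proof.
move=> /holo_germP hf f0 e e0.
have [r [r0 [M fM]]] := filter_ex (filterI (nbhs_right_gt (0 : R)) hf).
have [s s0 fs] := absconv_small r0 fM f0 e0.
near=> t; apply: fs; near: t; [exact: nbhs_right_gt | exact: nbhs_right_le].
Unshelve. all: end_near. Qed.

Lemma holo_near_neq0 f : holo_germ f -> f 0 != 0 ->
  \forall z \near (0 : 'rV[C]_n), f z != 0.
Proof.
move=> hf f0; have n0 := normc_gt0 f0.
have hg : holo_germ (fun z => f z - f 0) by exact: (holoD hf (holo_cst (- f 0))).
have := near_absconv_small hg (subrr _) (e := normc (f 0) / 2).
rewrite divr_gt0 // => /(_ isT) h; apply/near0P.
apply: filterS (filterI (nbhs_right_gt (0 : R)) h) => r [r0 ur] z zr.
have := absconv_le r0 ur zr; apply: contraTneq => ->.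
by rewrite sub0r normc_opp -ltNge ltr_pdivrMr // ltr_pMr // ltr1n.
Qed.

(** Neumann series: [g = 1 - f / f 0] vanishes at 0, so its norm is at most 1/2 on a small polydisc,
    where the sum of the [g ^ k] converges to [f 0 / f]. *)
Lemma holoV f : holo_germ f -> f 0 != 0 -> holo_germ (fun z => (f z)^-1).
Proof.
move=> hf f0; pose g z := 1 + - ((f 0)^-1 * f z).
have hg : holo_germ g by apply: holoD (holo_cst _) (holoN (holoM (holo_cst _) hf)).
have g0 : g 0 = 0 by rewrite /g mulVf // subrr.
have h12 : 0 < 2^-1 :> R by rewrite invr_gt0.
have h12' : 2^-1 < 1 :> R by rewrite invf_lt1 ?ltr1n.
have [r [r0 gr]] :=
  filter_ex (filterI (nbhs_right_gt (0 : R)) (near_absconv_small hg g0 h12)).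
suff H : absconv r (fun z => (1 - g z)^-1) (1 - 2^-1)^-1.
  apply: holo_ext (holoM (holo_cst (f 0)^-1) (absconv_holo r0 H)).
  move=> z; rewrite /g opprD addrA subrr add0r opprK invfM invrK mulrA.
  by rewrite mulVf // mul1r.
apply: (absconv_infsum r0 (f := fun k z => g z ^+ k) (m := fun k => 2^-1 ^+ k)).
- by move=> k; apply: absconvX.
- by move=> F; apply: geom_fset => //; apply: ltW.
- by move=> z zr; apply: (has_sum_geom (q := 2^-1)) => //; apply: absconv_le gr zr.
Qed.

Lemma holo_comp (c : cfun R n) (Phi : 'I_n -> cfun R n) : holo_germ c ->
  (forall i, holo_germ (Phi i)) -> (forall i, Phi i 0 = 0) ->
  holo_germ (fun z => c (\row_i Phi i z)).
Proof.
move=> /holo_germP hc hPhi Phi0.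
have [rho [rho0 [M cM]]] := filter_ex (filterI (nbhs_right_gt (0 : R)) hc).
have : \forall r \near (0 : R)^'+, forall i, absconv r (Phi i) rho.
  by apply: filter_forall => i; apply: near_absconv_small.
move=> /(filterI (nbhs_right_gt (0 : R)))/filter_ex [r [r0 hr]].
exact: absconv_holo r0 (absconv_comp r0 rho0 cM hr).
Qed.

Lemma holo_det d (A : 'rV[C]_n -> 'M[C]_d) : (forall i j, holo_germ (fun z => A z i j)) ->
  holo_germ (fun z => \det (A z)).
Proof.
move=> hA; apply: holo_sum => s _; apply: holoM; first exact: holo_cst.
exact: holo_prod.
Qed.

Lemma holo_adj d (A : 'rV[C]_n -> 'M[C]_d) i j : (forall i j, holo_germ (fun z => A z i j)) ->
  holo_germ (fun z => (\adj (A z)) i j).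
Proof.
move=> hA; have hd : holo_germ (fun z => \det (row' j (col' i (A z)))).
  apply: holo_det => k l; apply: holo_ext (hA (lift j k) (lift i l)).
  by move=> z; rewrite !mxE.
apply: holo_ext (holoM (holo_cst ((-1) ^+ (j + i))) hd).
by move=> z; rewrite mxE.
Qed.
End Germs.

(** * Ideals and finite quotients *)

Section Ideals.
Variables (R : realType) (n : nat).
Local Notation C := R[i].
Implicit Types (f g : cfun R n) (s : seq (cfun R n)) (z : 'rV[C]_n).

Lemma ideal_near s f g : (\forall z \near (0 : 'rV[C]_n), f z = g z) ->
  ideal_of s f -> ideal_of s g.
Proof.
move=> fg [c hc hf]; exists c => //.
by apply: filterS2 fg hf => z <-.
Qed.

Lemma ideal_ext s f g : f =1 g -> ideal_of s f -> ideal_of s g.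
Proof. by move/funext->. Qed.

Lemma ideal0 s : ideal_of s (fun=> 0).
Proof.
exists (fun _ _ => 0) => [i|]; first exact: holo_cst.
by near=> z; rewrite big1 // => i _; rewrite mul0r.
Unshelve. all: end_near. Qed.

Lemma idealD s f g : ideal_of s f -> ideal_of s g -> ideal_of s (fun z => f z + g z).
Proof.
move=> [a ha hf] [b hb hg]; exists (fun i z => a i z + b i z) => [i|].
  exact: (holoD (ha i) (hb i)).
apply: filterS2 hf hg => z -> ->; rewrite -big_split.
by apply: eq_bigr => i _; rewrite mulrDl.
Qed.

Lemma idealM s c f : holo_germ c -> ideal_of s f -> ideal_of s (fun z => c z * f z).
Proof.
move=> hc [a ha hf]; exists (fun i z => c z * a i z) => [i|]; first exact: (holoM hc (ha i)).
apply: filterS hf => z ->; rewrite mulr_sumr.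
by apply: eq_bigr => i _; rewrite mulrA.
Qed.

Lemma idealN s f : ideal_of s f -> ideal_of s (fun z => - f z).
Proof.
move=> hf; apply: ideal_ext (idealM (holo_cst n (-1)) hf) => z.
by rewrite mulN1r.
Qed.

Lemma ideal_sum s (T : Type) (t : seq T) (P : pred T) (f : T -> cfun R n) :
  (forall x, P x -> ideal_of s (f x)) -> ideal_of s (fun z => \sum_(x <- t | P x) f x z).
Proof.
move=> h; elim: t => [|x t IH].
  by apply: ideal_ext (ideal0 s) => z; rewrite big_nil.
have [Px|Px] := boolP (P x).
  by apply: ideal_ext (idealD (h _ Px) IH) => z; rewrite big_cons Px.
by apply: ideal_ext IH => z; rewrite big_cons (negbTE Px).
Qed.

Lemma ideal_gen s i : (i < size s)%N -> ideal_of s (s`_i).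
Proof.
move=> h; exists (fun (k : 'I_(size s)) _ => (k == Ordinal h)%:R) => [k|].
  exact: holo_cst.
near=> z; rewrite (bigD1 (Ordinal h)) //= eqxx mul1r big1 ?addr0 // => k /negbTE->.
by rewrite mul0r.
Unshelve. all: end_near. Qed.

Lemma ideal_unit s f : holo_germ f -> f 0 != 0 -> ideal_of s f -> ideal_of s (fun=> 1).
Proof.
move=> hf f0 sf; apply: ideal_near (idealM (holoV hf f0) sf).
by apply: filterS (holo_near_neq0 hf f0) => z fz; rewrite mulVf.
Qed.

Lemma ideal_catl s1 s2 f : ideal_of s1 f -> ideal_of (s1 ++ s2) f.
Proof.
move=> [a ha hf].
have : ideal_of (s1 ++ s2) (fun z => \sum_(i < size s1) a i z * s1`_i z).
  apply: ideal_sum => i _; apply: idealM => //.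
  have := @ideal_gen (s1 ++ s2) i; rewrite nth_cat ltn_ord size_cat; apply.
  by apply: leq_trans (leq_addr _ _).
by apply: ideal_near; apply: filterS hf => z ->.
Qed.

Lemma ideal_catr s1 s2 f : ideal_of s2 f -> ideal_of (s1 ++ s2) f.
Proof.
move=> [a ha hf].
have : ideal_of (s1 ++ s2) (fun z => \sum_(i < size s2) a i z * s2`_i z).
  apply: ideal_sum => i _; apply: idealM => //.
  have := @ideal_gen (s1 ++ s2) (size s1 + i).
  have L : (size s1 + i < size s1)%N = false by rewrite ltnNge leq_addr.
  by rewrite nth_cat L addKn size_cat ltn_add2l; apply.
by apply: ideal_near; apply: filterS hf => z ->.
Qed.

Lemma ideal_cat s1 s2 g : ideal_of (s1 ++ s2) g ->
  exists (a : 'I_(size s1) -> cfun R n) (b : 'I_(size s2) -> cfun R n),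
  [/\ forall i, holo_germ (a i), forall i, holo_germ (b i) &
   \forall z \near (0 : 'rV[C]_n),
     g z = \sum_(i < size s1) a i z * s1`_i z + \sum_(i < size s2) b i z * s2`_i z].
Proof.
move=> [c hc hg]; have E := esym (size_cat s1 s2).
exists (fun i => c (cast_ord E (lshift _ i))), (fun i => c (cast_ord E (rshift _ i))).
split=> //; apply: filterS hg => z ->.
rewrite (reindex (cast_ord E)) /=; last first.
  by exists (cast_ord (esym E)) => i _; rewrite ?cast_ordK ?cast_ordKV.
rewrite big_split_ord /=; congr (_ + _); apply: eq_bigr => i _.
  by rewrite nth_cat ltn_ord.
by rewrite nth_cat ltnNge leq_addr /= addKn.
Qed.

(** The determinant trick: multiplying [B e] by the adjugate puts every [det B * e k] in the ideal.
    Since 1 is a combination of the [e k] modulo the ideal, [det B] is in it as well. *)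
Lemma ideal_det s d (B : 'rV[C]_n -> 'M[C]_d) (e : 'I_d -> cfun R n) (c : 'I_d -> cfun R n) :
  (forall i j, holo_germ (fun z => B z i j)) -> (forall i, holo_germ (c i)) ->
  (forall i, ideal_of s (fun z => \sum_(k < d) B z i k * e k z)) ->
  ideal_of s (fun z => 1 - \sum_(k < d) c k z * e k z) ->
  ideal_of s (fun z => \det (B z)).
Proof.
move=> hB hc hBe h1.
have he k : ideal_of s (fun z => \det (B z) * e k z).
  have : ideal_of s (fun z => \sum_(i < d) (\adj (B z)) k i * \sum_(l < d) B z i l * e l z).
    by apply: ideal_sum => i _; apply: idealM => //; apply: holo_adj.
  apply: ideal_ext => z; pose v := \col_i e i z.
  transitivity ((\adj (B z) *m (B z *m v)) k 0).
    by rewrite mxE; apply: eq_bigr => i _; rewrite [(B z *m v) i 0]mxE; congr (_ * _);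
      apply: eq_bigr => l _; rewrite mxE.
  by rewrite mulmxA mul_adj_mx mul_scalar_mx !mxE.
have h2 : ideal_of s (fun z => \sum_(k < d) c k z * (\det (B z) * e k z)).
  by apply: ideal_sum => k _; apply: idealM.
apply: ideal_ext (idealD (idealM (holo_det hB) h1) h2) => z.
rewrite mulrBr mulr1 mulr_sumr -addrA; rewrite [X in _ + X](_ : _ = 0) ?addr0 //.
by rewrite -sumrN -big_split big1 // => k _ /=; rewrite mulrCA addNr.
Qed.

Section Basis.
Variables (s : seq (cfun R n)) (d : nat) (e : 'I_d -> cfun R n).
Hypothesis eB : quot_basis (ideal_of s) e.

Lemma basis_holo i : holo_germ (e i). Proof. by case: eB. Qed.

Lemma basis_span g : holo_germ g ->
  exists c : 'rV[C]_d, ideal_of s (fun z => g z - \sum_(i < d) c 0 i * e i z).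
Proof. by move=> hg; have [_ /(_ g hg) [c [hc _]]] := eB; exists c. Qed.

(** Both [c] and the zero row represent the germ 0, so uniqueness identifies them. *)
Lemma basis_free (c : 'rV[C]_d) : ideal_of s (fun z => \sum_(i < d) c 0 i * e i z) -> c = 0.
Proof.
move=> hc; have [_ /(_ _ (holo_cst n 0)) [c' [_ hu]]] := eB.
rewrite -(hu c); last by apply: ideal_ext (idealN hc) => z; rewrite sub0r.
apply: hu; apply: ideal_ext (ideal0 s) => z; rewrite big1 ?subr0 // => i _.
by rewrite mxE mul0r.
Qed.

(** If the quotient is zero, every row of coefficients represents 0; by uniqueness the all-ones row
    equals the zero row, which forces its length to be 0. *)
Lemma basis_ideal1 : ideal_of s (fun=> 1) -> d = 0%N.
Proof.
move=> h1; case: {+}d e eB => // d' e' eB'.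
have /(congr1 (fun v : 'rV_d'.+1 => v 0 0)) : const_mx 1 = 0 :> 'rV[C]_d'.+1.
  case: eB' => e'_holo eB'; have [c' [_ hu]] := eB' _ (holo_cst n 0).
  have hI g : holo_germ g -> ideal_of s g.
    by move=> hg; apply: ideal_ext (idealM hg h1) => z; rewrite mulr1.
  have hc (c : 'rV[C]_d'.+1) : ideal_of s (fun z => 0 - \sum_(i < d'.+1) c 0 i * e' i z).
    apply: hI; apply: (holoD (holo_cst n 0)); apply: holoN; apply: holo_sum => i _.
    exact: (holoM (holo_cst n (c 0 i)) (e'_holo i)).
  by rewrite -(hu _ (hc (const_mx 1))) (hu _ (hc 0)).
by rewrite !mxE => /eqP; rewrite oner_eq0.
Qed.

Lemma basis_mulmx u : holo_germ u ->
  exists U : 'M[C]_d, forall i, ideal_of s (fun z => u z * e i z - \sum_(k < d) U i k * e k z).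
Proof.
move=> hu; have /choice [c hc] i := basis_span (holoM hu (basis_holo i)).
exists (\matrix_i c i) => i; apply: ideal_ext (hc i) => z; congr (_ - _).
by apply: eq_bigr => k _; rewrite mxE.
Qed.

(* u - a is a unit for a != 0, so 0 is the only eigenvalue of multiplication by u. *)
Lemma basis_char_poly u (U : 'M[C]_d) : holo_germ u -> u 0 = 0 ->
  (forall i, ideal_of s (fun z => u z * e i z - \sum_(k < d) U i k * e k z)) ->
  char_poly U = 'X^d.
Proof.
move=> hu u0 hU.
have ev a : root (char_poly U) a -> a = 0.
  rewrite -eigenvalue_root_char => /eigenvalueP [v vU v0].
  apply/eqP/negPn/negP => a0; move/eqP: v0; apply.
  apply: basis_free.
  have hua : holo_germ (fun z => u z - a) by exact: (holoD hu (holo_cst n (- a))).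
  have ua0 : u 0 - a != 0 by rewrite u0 sub0r oppr_eq0.
  have hi := holoV hua ua0.
  have h : ideal_of s (fun z => \sum_(i < d) v 0 i * (u z * e i z - \sum_(k < d) U i k * e k z)).
    by apply: ideal_sum => i _; exact: (idealM (holo_cst n (v 0 i)) (hU i)).
  (* Row [i] of [U] holds the coordinates of [u * e i], so an eigenvalue for row vectors is what is
     needed: [v U = a v] puts [(u - a) * sum v_i e_i] in the ideal, and inverting [u - a]
     contradicts freeness. *)
  have E z : \sum_(i < d) v 0 i * (u z * e i z - \sum_(k < d) U i k * e k z) =
             (u z - a) * \sum_(i < d) v 0 i * e i z.
    rewrite mulrBl; under eq_bigr do rewrite mulrBr.
    rewrite sumrB; congr (_ - _).
      by rewrite mulr_sumr; apply: eq_bigr => i _; rewrite mulrCA.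
    under eq_bigr do rewrite mulr_sumr.
    rewrite exchange_big mulr_sumr; apply: eq_bigr => k _ /=.
    have := congr1 (fun A : 'rV_d => A 0 k) vU; rewrite !mxE mulrA => <-.
    by rewrite mulr_suml; apply: eq_bigr => i _; rewrite mulrA.
  have hz := holo_near_neq0 hua ua0.
  apply: ideal_near (idealM hi h); apply: filterS hz => z uz.
  by rewrite E mulrA mulVf // mul1r.
(* The characteristic polynomial splits over C with all roots 0, so it is a power of X, and its size
   gives the exponent [d]. *)
have [rs Ers] := closed_field_poly_normal (char_poly U).
rewrite (monicP (char_poly_monic U)) scale1r in Ers.
have r0 x : x \in rs -> x = 0 by move=> xr; apply: ev; rewrite Ers root_prod_XsubC.
have : char_poly U = 'X ^+ size rs.
  rewrite Ers (eq_big_seq (fun=> 'X)) => [|x /r0 ->]; last by rewrite subr0.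
  by rewrite big_const_seq count_predT iter_mulr_1.
move=> E; have := size_char_poly U; rewrite E size_polyXn => -[->] //.
Qed.

Lemma det_char_poly (U : 'M[C]_d) (x : C) : \det (x%:M - U) = (char_poly U).[x].
Proof.
rewrite /char_poly -horner_evalE -det_map_mx; congr (\det _).
by apply/matrixP => i j; rewrite !mxE /= horner_evalE !hornerE hornerMn hornerX.
Qed.

(** The determinant trick for the matrix [u - U], whose determinant is the characteristic polynomial
    of [U] at [u], that is [u ^ d]. Applied to the coordinates, it yields the powers used to divide
    monomials. *)
Lemma basis_nilp u : holo_germ u -> u 0 = 0 -> ideal_of s (fun z => u z ^+ d).
Proof.
move=> hu u0; have [U hU] := basis_mulmx hu.
have [c hc] := basis_span (holo_cst n 1).
have := ideal_det (B := fun z => (u z)%:M - U) (e := e) (c := fun i _ => c 0 i) _ _ _ hc.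
have E z : \det ((u z)%:M - U) = u z ^+ d.
  by rewrite det_char_poly (basis_char_poly hu u0 hU) hornerXn.
under eq_fun do rewrite E.
apply.
- move=> i j; apply: holo_ext (holoD (holoM hu (holo_cst n ((i == j)%:R)))
    (holo_cst n (- U i j))) => z.
  by rewrite !mxE mulr_natr.
- by move=> i; apply: holo_cst.
- move=> i; apply: ideal_ext (hU i) => z.
  under [RHS]eq_bigr do rewrite !mxE mulrBl.
  rewrite sumrB; congr (_ - _); rewrite (bigD1 i) //= eqxx mulr1n big1 ?addr0 // => k.
  by rewrite eq_sym => /negbTE->; rewrite mulr0n mul0r.
Qed.

End Basis.
End Ideals.

(** * Division with estimates *)

Section DivisionStep.
Variables (R : realType) (n : nat).
Local Notation C := R[i].
Local Notation toC := (real_complex R).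
Variables (s1 s2 : seq (cfun R n)) (d : nat) (e : 'I_d -> cfun R n).
Hypothesis eB : quot_basis (ideal_of (s1 ++ s2)) e.
Implicit Types (f g : cfun R n) (z w : 'rV[C]_n).

(** [qc] holds the constant coordinates on [e], [qa] and [qb] the quotients by [s1] and [s2]. The
    last two are kept apart because only [qb] is divided again. *)
Record division := Division {
  qc : 'I_d -> C; qa : 'I_(size s1) -> cfun R n; qb : 'I_(size s2) -> cfun R n }.

Definition combination (x : division) : cfun R n := fun z =>
  \sum_(i < d) qc x i * e i z + \sum_(l < size s1) qa x l z * s1`_l z +
  \sum_(m < size s2) qb x m z * s2`_m z.

Definition divided (r M : R) g (x : division) :=
  [/\ forall i, normc (qc x i) <= M, forall l, absconv r (qa x l) M,
      forall m, absconv r (qb x m) M & forall z, cube r z -> g z = combination x z].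

Lemma dividedW r M N g x : M <= N -> divided r M g x -> divided r N g x.
Proof.
move=> MN [hc ha hb hg]; split=> // [i|l|m].
- by apply: le_trans MN.
- by apply: absconvW (ha l).
- by apply: absconvW (hb m).
Qed.

(** A single membership gives a division with some bound, depending on [g]. Prescribing [c] makes it
    possible to ask for [qc = 0]. *)
Lemma divided_near g (c : 'I_d -> C) :
  ideal_of (s1 ++ s2) (fun z => g z - \sum_(i < d) c i * e i z) ->
  \forall r \near (0 : R)^'+, exists M, 0 <= M /\ exists2 x, qc x = c & divided r M g x.
Proof.
move=> /ideal_cat [a [b [ha hb /near0P hg]]].
have Ha : \forall r \near (0 : R)^'+, forall l, exists M, absconv r (a l) M.
  by apply: filter_forall => l; apply/holo_germP.
have Hb : \forall r \near (0 : R)^'+, forall m, exists M, absconv r (b m) M.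
  by apply: filter_forall => m; apply/holo_germP.
apply: filterS3 Ha Hb hg => r /choice [Ma hMa] /choice [Mb hMb] hg.
have a0 l := absconv_ge0 (hMa l); have b0 m := absconv_ge0 (hMb m).
have sa0 : 0 <= \sum_l Ma l by apply: sumr_ge0.
have sb0 : 0 <= \sum_m Mb m by apply: sumr_ge0.
have sc0 : 0 <= \sum_i normc (c i) by apply: sumr_ge0 => i _; apply: normc_ge0.
(* The sum of all the bounds dominates each of them. *)
exists (\sum_i normc (c i) + \sum_l Ma l + \sum_m Mb m); split.
  by rewrite !addr_ge0.
exists (Division c a b) => //; split => [i|l|m|z zr] /=.
- rewrite (bigD1 i) //= -!addrA lerDl !addr_ge0 //.
  by apply: sumr_ge0 => k _; apply: normc_ge0.
- apply: absconvW (hMa l); rewrite addrAC [X in _ <= _ + X](bigD1 l) //= addrCA lerDl !addr_ge0 //.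
  exact: sumr_ge0.
- apply: absconvW (hMb m); rewrite [X in _ <= _ + X](bigD1 m) //= addrCA lerDl !addr_ge0 //.
  exact: sumr_ge0.
- by rewrite /combination /= -addrA -hg // addrC subrK.
Qed.

(** The hypothesis [qc x = 0] is essential: a product [f * c] with [c] a nonzero constant would no
    longer be a constant coordinate. *)
Lemma divided_scale r M N g f x : 0 < r -> (forall i, qc x i = 0) -> divided r M g x ->
  absconv r f N ->
  divided r (N * M) (fun z => f z * g z)
    (Division (fun=> 0) (fun l z => f z * qa x l z) (fun m z => f z * qb x m z)).
Proof.
move=> r0 x0 [hc ha hb hg] hf; split=> [i|l|m|z zr]; rewrite ?[qa _]/= ?[qb _]/=.
- rewrite -[qc _ i]/(0 : C); have N0 := absconv_ge0 hf.
  have : 0 <= M by apply: le_trans (hc i); apply: normc_ge0.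
  by rewrite normc0 => M0; rewrite mulr_ge0.
- exact: (absconvM r0 hf (ha l)).
- exact: (absconvM r0 hf (hb m)).
rewrite hg // /combination /=.
have -> : \sum_(i < d) qc x i * e i z = 0 by apply: big1 => i _; rewrite x0 mul0r.
have -> : \sum_(i < d) 0 * e i z = 0 by apply: big1 => i _; rewrite mul0r.
rewrite !add0r mulrDr !mulr_sumr; congr (_ + _); apply: eq_bigr => i _; exact: mulrA.
Qed.

(** Only finitely many monomials have all exponents below [d], and each is divided separately. Any
    other one is a monomial times some [z_i ^ d], which lies in the ideal by [basis_nilp]; the
    cofactor scales that division. Hence one [K] serves all monomials. *)
Lemma monomial_division : \forall r \near (0 : R)^'+, exists2 K, 0 <= K &
  forall be : {ffun 'I_n -> nat}, exists x, divided r (K * r ^+ deg be) (mono be) x.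
Proof.
pose low (be : {ffun 'I_n -> 'I_d}) : {ffun 'I_n -> nat} := [ffun i => val (be i)].
have H1 : \forall r \near (0 : R)^'+, forall be,
    exists M, 0 <= M /\ exists x, divided r M (mono (low be)) x.
  apply: filter_forall => be.
  have [|c hc] := basis_span eB (g := mono (low be)).
    by apply: holo_prod => i _; apply: holoX; apply: holo_coord.
  by apply: filterS (divided_near hc) => r [M [M0 [x _ hx]]]; exists M; split=> //; exists x.
have H2 : \forall r \near (0 : R)^'+, forall i, exists M, 0 <= M /\ exists2 x,
    qc x = (fun=> 0) & divided r M (fun z : 'rV[C]_n => z 0 i ^+ d) x.
  apply: filter_forall => i; apply: divided_near.
  have := basis_nilp eB (holo_coord R i) _; rewrite mxE => /(_ erefl).
  apply: ideal_ext => z; rewrite big1 ?subr0 // => k _; by rewrite mul0r.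
apply: filterS3 (nbhs_right_gt (0 : R)) H1 H2 => r r0 /choice [M1 hM1] /choice [M2 hM2].
have t1 be : 0 <= M1 be / r ^+ deg (low be).
  by rewrite divr_ge0 ?exprn_ge0 ?(ltW r0) //; case: (hM1 be).
have t2 i : 0 <= M2 i / r ^+ d.
  by rewrite divr_ge0 ?exprn_ge0 ?(ltW r0) //; case: (hM2 i).
have T1 : 0 <= \sum_be M1 be / r ^+ deg (low be) by apply: sumr_ge0.
have T2 : 0 <= \sum_i M2 i / r ^+ d by apply: sumr_ge0.
(* Each bound is taken relative to the norm of its monomial, and the finitely many ratios are
   added. *)
exists (\sum_be M1 be / r ^+ deg (low be) + \sum_i M2 i / r ^+ d); first exact: addr_ge0.
move=> be; have rX k : 0 < r ^+ k by apply: exprn_gt0.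
have [/forallP small|] := boolP [forall i, (be i < d)%N].
  have -> : be = low [ffun i => Ordinal (small i)].
    by apply/ffunP => i; rewrite !ffunE.
  move: [ffun i => Ordinal (small i)] => be'.
  have [_ [x hx]] := hM1 be'; exists x; apply: dividedW hx.
  rewrite -ler_pdivrMr // (bigD1 be') //= -addrA lerDl addr_ge0 //.
  exact: sumr_ge0.
rewrite negb_forall => /existsP [] i; rewrite -leqNgt => di.
have [_ [x x0 hx]] := hM2 i.
pose be' : {ffun 'I_n -> nat} := [ffun k => if k == i then (be k - d)%N else be k].
have beE : be = midx_add be' (midx_nat i d).
  apply/ffunP => k; rewrite !ffunE; case: eqP => [->|_]; last by rewrite addn0.
  by rewrite subnK.
have hm : absconv r (mono be') (r ^+ deg be').
  have := absconv_mono r0 be' 1; rewrite normc1 mul1r; apply: absconv_eq => z _.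
  by rewrite mul1r.
exists (Division (fun=> 0) (fun l z => mono be' z * qa x l z) (fun m z => mono be' z * qb x m z)).
have := divided_scale r0 _ hx hm; rewrite x0 => /(_ (fun=> erefl)) hd.
have degE : deg be = (deg be' + d)%N by rewrite {1}beE degD deg_nat.
have le : r ^+ deg be' * M2 i <=
    (\sum_be M1 be / r ^+ deg (low be) + \sum_i M2 i / r ^+ d) * r ^+ deg be.
  rewrite degE exprD mulrCA; apply: ler_wpM2l; first exact: ltW.
  rewrite -ler_pdivrMr // [X in _ + X](bigD1 i) //= addrCA lerDl addr_ge0 //.
  exact: sumr_ge0.
have := dividedW le hd; congr divided; apply/funext => z.
by rewrite {1}beE monoD mono_nat.
Qed.

(** Superposition of the monomial divisions, weighted by the coefficients of [g]: their bounds
    [K * r ^ deg al] carry the weights of the l1-norm, so everything sums to at most [K * M]. *)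
Lemma series_division : \forall r \near (0 : R)^'+, exists2 K, 0 <= K &
  forall g M, absconv r g M -> exists x, divided r (K * M) g x.
Proof.
apply: filterS2 (nbhs_right_gt (0 : R)) monomial_division => r r0 [K K0 /choice [x hx]].
exists K => // g M [u [uM hg]].
have uK (F : {fset {ffun 'I_n -> nat}}) : \sum_(al <- F) normc (u al) * (K * r ^+ deg al) <= K * M.
  rewrite (eq_bigr (fun al => K * normc (u al * toC r ^+ deg al))) => [|al _].
    by rewrite -mulr_sumr; apply: ler_wpM2l.
  by rewrite normcM normc_realX ?(ltW r0) // mulrCA.
have bK (v : {ffun 'I_n -> nat} -> C) : (forall al, normc (v al) <= K * r ^+ deg al) ->
    abs_sum_le (fun al => u al * v al) (K * M).
  move=> hv F; apply: le_trans (uK F); apply: ler_sum => al _; rewrite normcM.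
  by apply: ler_wpM2l; rewrite ?normc_ge0.
have hc i : abs_sum_le (fun al => u al * qc (x al) i) (K * M).
  by apply: bK => al; case: (hx al).
have ha l z : cube r z -> abs_sum_le (fun al => u al * qa (x al) l z) (K * M).
  by move=> zr; apply: bK => al; case: (hx al) => _ h _ _; apply: absconv_le (h l) zr.
have hb m z : cube r z -> abs_sum_le (fun al => u al * qb (x al) m z) (K * M).
  by move=> zr; apply: bK => al; case: (hx al) => _ _ h _; apply: absconv_le (h m) zr.
exists (Division (fun i => tsum (fun al => u al * qc (x al) i))
  (fun l z => tsum (fun al => u al * qa (x al) l z))
  (fun m z => tsum (fun al => u al * qb (x al) m z))); split=> [i|l|m|z zr] /=.
- exact: has_sum_norm_le (hc i) (has_sum_tsum (hc i)).
- apply: (absconv_infsum r0 (f := fun al z => u al * qa (x al) l z)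
    (m := fun al => normc (u al) * (K * r ^+ deg al))) => // [al|z zr].
    by apply: absconvZ => //; case: (hx al).
  exact: has_sum_tsum (ha l z zr).
- apply: (absconv_infsum r0 (f := fun al z => u al * qb (x al) m z)
    (m := fun al => normc (u al) * (K * r ^+ deg al))) => // [al|z zr].
    by apply: absconvZ => //; case: (hx al).
  exact: has_sum_tsum (hb m z zr).
(* The combination of the summed quotients is the sum of the combinations, and these are the terms
   of the series of [g]. *)
apply: has_sum_unique (hg z zr) _; rewrite /combination /=.
have h1 := has_sum_sum (index_enum 'I_d) (fun i => has_sumZ (e i z) (has_sum_tsum (hc i))).
have h2 := has_sum_sum (index_enum 'I_(size s1))
  (fun l => has_sumZ (s1`_l z) (has_sum_tsum (ha l z zr))).
have h3 := has_sum_sum (index_enum 'I_(size s2))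
  (fun m => has_sumZ (s2`_m z) (has_sum_tsum (hb m z zr))).
have := has_sumD (has_sumD h1 h2) h3.
under [X in has_sum _ (X + _ + _)]eq_bigr do rewrite mulrC.
under [X in has_sum _ (_ + X + _)]eq_bigr do rewrite mulrC.
under [X in has_sum _ (_ + _ + X)]eq_bigr do rewrite mulrC.
apply: eq_has_sum => al; case: (hx al) => _ _ _ -> //; rewrite /combination !mulrDr !mulr_sumr.
by congr (_ + _ + _); apply: eq_bigr => i _; rewrite mulrC mulrA.
Qed.

End DivisionStep.

(** * Iterated division and the preparation theorem *)

Section Preparation.
Variables (R : realType) (n : nat).
Local Notation C := R[i].
Variables (s1 s2 : seq (cfun R n)) (d : nat) (e : 'I_d -> cfun R n).
Implicit Types (f g : cfun R n) (z w : 'rV[C]_n).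

Section Iteration.
Variables (phi : 'I_n -> cfun R n) (idx : 'I_(size s2) -> 'I_n).
Hypothesis s2E : forall (m : 'I_(size s2)) z, s2`_m z = phi (idx m) z.
Variables (r K : R).
Hypotheses (r0 : 0 < r) (K0 : 0 <= K).
(** A fixed choice of division. The bound is an argument because it changes along the iteration:
    [M], [K * M], [K * (K * M)], and so on. *)
Variable Q : cfun R n -> R -> division s1 s2 d.
Hypothesis QP : forall g M, absconv r g M -> divided e r (K * M) g (Q g M).

(* The terms of degree t in w of the iterated division, in which w stands for the
   values of phi. *)
Fixpoint coef t g (M : R) : 'I_d -> cfun R n :=
  if t is t'.+1 then fun i w =>
    \sum_(m < size s2) w 0 (idx m) * coef t' (qb (Q g M) m) (K * M) i w
  else fun i _ => qc (Q g M) i.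

(** In contrast with [coef], this is a function of [z], since the coefficients on [s1] are arbitrary
    germs. *)
Fixpoint ideal_part t g (M : R) : 'I_(size s1) -> cfun R n :=
  if t is t'.+1 then fun l z =>
    \sum_(m < size s2) s2`_m z * ideal_part t' (qb (Q g M) m) (K * M) l z
  else qa (Q g M).

(** What is still to be divided after [t] rounds. *)
Fixpoint remainder t g (M : R) : cfun R n :=
  if t is t'.+1 then fun z =>
    \sum_(m < size s2) s2`_m z * remainder t' (qb (Q g M) m) (K * M) z
  else g.

Definition layer t g M z :=
  \sum_(i < d) coef t g M i (\row_k phi k z) * e i z +
  \sum_(l < size s1) ideal_part t g M l z * s1`_l z.

Variables (rho s : R).
Hypotheses (rho0 : 0 < rho) (s0 : 0 < s) (sr : s <= r).
Hypothesis phi_s : forall k, absconv s (phi k) rho.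
Local Notation q := ((size s2)%:R * (rho * K)).

Lemma iter_bound (M t : R) : \sum_(m < size s2) rho * (K * M * t) = M * (q * t).
Proof. by rewrite sumr_const card_ord -mulr_natl; ring. Qed.

Lemma s2_s (m : 'I_(size s2)) : absconv s (s2`_m) rho.
Proof. by apply: absconv_eq (phi_s (idx m)) => z _; rewrite s2E. Qed.

(** A round costs [K] for the division, [rho] for the factor [w_m] and [size s2] for the number of
    terms, whence the ratio [q]. The coefficients live on the polydisc of radius [rho] in [w], the
    ideal parts and remainders on that of radius [s] in [z]. *)
Lemma coef_bound t g M i : absconv r g M -> absconv rho (coef t g M i) (K * M * q ^+ t).
Proof.
elim: t g M => [|t IH] g M gM /=; have [hc _ hb _] := QP gM.
  by apply: absconvW (absconv_cst n rho0 _); rewrite expr0 mulr1; apply: hc.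
rewrite exprS; have -> : K * M * (q * q ^+ t) = K * (M * (q * q ^+ t)) by ring.
rewrite -iter_bound mulr_sumr; apply: absconv_sum => // m _.
have -> : K * (rho * (K * M * q ^+ t)) = rho * (K * (K * M) * q ^+ t) by ring.
exact: (absconvM rho0 (absconv_coord rho0 (idx m)) (IH _ _ (hb m))).
Qed.

Lemma ideal_part_bound t g M l : absconv r g M ->
  absconv s (ideal_part t g M l) (K * M * q ^+ t).
Proof.
elim: t g M => [|t IH] g M gM /=; have [_ ha hb _] := QP gM.
  by rewrite expr0 mulr1; apply: absconv_shrink (ha l).
rewrite exprS; have -> : K * M * (q * q ^+ t) = K * (M * (q * q ^+ t)) by ring.
rewrite -iter_bound mulr_sumr; apply: absconv_sum => // m _.
have -> : K * (rho * (K * M * q ^+ t)) = rho * (K * (K * M) * q ^+ t) by ring.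
exact: (absconvM s0 (s2_s m) (IH _ _ (hb m))).
Qed.

Lemma remainder_bound t g M : absconv r g M -> absconv s (remainder t g M) (M * q ^+ t).
Proof.
elim: t g M => [|t IH] g M gM /=; have [_ ha hb _] := QP gM.
  by rewrite expr0 mulr1; apply: absconv_shrink gM.
rewrite exprS -iter_bound; apply: absconv_sum => // m _.
exact: (absconvM s0 (s2_s m) (IH _ _ (hb m))).
Qed.

Lemma layerS t g M z :
  layer t.+1 g M z = \sum_(m < size s2) s2`_m z * layer t (qb (Q g M) m) (K * M) z.
Proof.
rewrite /layer /=; under [RHS]eq_bigr do rewrite mulrDr.
rewrite big_split /=; congr (_ + _).
  under [RHS]eq_bigr do rewrite mulr_sumr.
  rewrite exchange_big; apply: eq_bigr => i _; rewrite mulr_suml.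
  by apply: eq_bigr => m _; rewrite mxE s2E mulrA.
under [RHS]eq_bigr do rewrite mulr_sumr.
rewrite exchange_big; apply: eq_bigr => l _; rewrite mulr_suml.
by apply: eq_bigr => m _; rewrite mulrA.
Qed.

Lemma iterated_division t g M z : absconv r g M -> cube s z ->
  g z = \sum_(k < t) layer k g M z + remainder t g M z.
Proof.
move=> + zs; elim: t g M => [|t IH] g M gM; first by rewrite big_ord0 add0r.
have [_ _ hb hg] := QP gM; rewrite hg /combination; last exact: cubeW zs.
rewrite big_ord_recl /= -[RHS]addrA; congr (_ + _).
under [X in _ = X + _]eq_bigr => k _ do rewrite /bump /= add1n layerS.
rewrite exchange_big -big_split; apply: eq_bigr => m _ /=.
by rewrite (IH _ _ (hb m)) mulrC mulrDr mulr_sumr.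
Qed.

Hypothesis q1 : q < 1.

Lemma q_ge0 : 0 <= q.
Proof. by rewrite mulr_ge0 ?ler0n // mulr_ge0 // ltW. Qed.

Lemma sum_geom (M : R) (F : {fset nat}) : 0 <= M ->
  \sum_(t <- F) M * q ^+ t <= M * (1 - q)^-1.
Proof. by move=> M0; rewrite -mulr_sumr; apply: ler_wpM2l => //; apply: geom_fset q_ge0 q1. Qed.

Definition limit_coef g M i w : C := tsum (fun t => coef t g M i w).
Definition limit_ideal_part g M l z : C := tsum (fun t => ideal_part t g M l z).

Lemma coef_has_sum g M i w : absconv r g M -> cube rho w ->
  has_sum (fun t => coef t g M i w) (limit_coef g M i w).
Proof.
move=> gM hw; apply: (has_sum_tsum (M := K * M * (1 - q)^-1)) => F.
apply: le_trans (sum_geom F _); last by rewrite mulr_ge0 // (absconv_ge0 gM).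
by apply: ler_sum => t _; apply: absconv_le hw; last exact: coef_bound.
Qed.

Lemma ideal_part_has_sum g M l z : absconv r g M -> cube s z ->
  has_sum (fun t => ideal_part t g M l z) (limit_ideal_part g M l z).
Proof.
move=> gM hz; apply: (has_sum_tsum (M := K * M * (1 - q)^-1)) => F.
apply: le_trans (sum_geom F _); last by rewrite mulr_ge0 // (absconv_ge0 gM).
by apply: ler_sum => t _; apply: absconv_le hz; last exact: ideal_part_bound.
Qed.

Lemma limit_coef_bound g M i : absconv r g M ->
  absconv rho (limit_coef g M i) (K * M * (1 - q)^-1).
Proof.
move=> gM; apply: (absconv_infsum rho0 (f := fun t => coef t g M i)
    (m := fun t => K * M * q ^+ t)) => [t|F|w hw].
- exact: coef_bound.
- by apply: sum_geom; rewrite mulr_ge0 // (absconv_ge0 gM).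
- exact: coef_has_sum.
Qed.

Lemma limit_ideal_part_bound g M l : absconv r g M ->
  absconv s (limit_ideal_part g M l) (K * M * (1 - q)^-1).
Proof.
move=> gM; apply: (absconv_infsum s0 (f := fun t => ideal_part t g M l)
    (m := fun t => K * M * q ^+ t)) => [t|F|z hz].
- exact: ideal_part_bound.
- by apply: sum_geom; rewrite mulr_ge0 // (absconv_ge0 gM).
- exact: ideal_part_has_sum.
Qed.

(** The layers sum to the right-hand side by linearity, and to [g z] by [iterated_division], because
    the remainder is at most [M * q ^ T]. *)
Lemma limit_division g M z : absconv r g M -> cube s z ->
  g z = \sum_(i < d) limit_coef g M i (\row_k phi k z) * e i z +
        \sum_(l < size s1) limit_ideal_part g M l z * s1`_l z.
Proof.
move=> gM zs.
have phiz : cube rho (\row_k phi k z).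
  by move=> k; rewrite mxE; apply: absconv_le zs.
have h1 := has_sum_sum (index_enum 'I_d) (fun i => has_sumZ (e i z) (coef_has_sum i gM phiz)).
have h2 := has_sum_sum (index_enum 'I_(size s1))
  (fun l => has_sumZ (s1`_l z) (ideal_part_has_sum l gM zs)).
have := has_sumD h1 h2.
under [X in has_sum _ (X + _)]eq_bigr do rewrite mulrC.
under [X in has_sum _ (_ + X)]eq_bigr do rewrite mulrC.
move=> h; have {}h : has_sum (fun t => layer t g M z)
   (\sum_(i < d) limit_coef g M i (\row_k phi k z) * e i z +
        \sum_(l < size s1) limit_ideal_part g M l z * s1`_l z).
  apply: eq_has_sum h => t; rewrite /layer.
  by congr (_ + _); apply: eq_bigr => i _; rewrite mulrC.
suff h' : has_sum (fun t => layer t g M z) (g z) by exact: has_sum_unique h' h.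
have [N hN] := abs_sum_le_exists h.
apply: (has_sum_series hN) => eps eps0.
have [T0 hT] := geom_small M q_ge0 q1 eps0.
exists T0 => T /hT; apply: le_trans.
rewrite {1}(iterated_division T gM zs) opprD addrA subrr add0r normc_opp.
exact: (absconv_le s0 (remainder_bound T gM) zs).
Qed.

Lemma coef_dep t g M i w w' : (forall m, w 0 (idx m) = w' 0 (idx m)) ->
  coef t g M i w = coef t g M i w'.
Proof.
move=> ww'; elim: t g M => [//|t IH] g M /=.
by apply: eq_bigr => m _; rewrite ww' IH.
Qed.

Lemma limit_coef_dep g M i w w' : (forall m, w 0 (idx m) = w' 0 (idx m)) ->
  limit_coef g M i w = limit_coef g M i w'.
Proof. by move=> ww'; congr tsum; apply/funext => t; apply: coef_dep. Qed.

(** Every term of positive degree has a factor [w_m]. So the values at 0 are the coordinates of [g]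
    on [e] modulo the full ideal. *)
Lemma limit_coef0 g M i : limit_coef g M i 0 = qc (Q g M) i.
Proof.
apply: (@tsumE _ _ _ (coef 0 g M i 0)); apply: has_sum_single => -[//|t] _ /=.
by rewrite big1 // => m _; rewrite mxE mul0r.
Qed.

End Iteration.

(** The germs [e] generate O_n / (s1) over the convergent power series in the elements of [s2]. The
    radius [r] and the constant [K] come first, then [rho] depending on [K], then [s] so small that
    the [phi k] have norm at most [rho]. *)
Lemma weierstrass_preparation (phi : 'I_n -> cfun R n) (idx : 'I_(size s2) -> 'I_n) :
  quot_basis (ideal_of (s1 ++ s2)) e ->
  (forall m : 'I_(size s2), s2`_m = phi (idx m)) ->
  (forall k, holo_germ (phi k)) -> (forall k, phi k 0 = 0) ->
  forall g, holo_germ g -> exists c : 'I_d -> cfun R n,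
  [/\ forall i, holo_germ (c i),
      forall i w w', (forall m, w 0 (idx m) = w' 0 (idx m)) -> c i w = c i w',
      ideal_of s1 (fun z => g z - \sum_(i < d) c i (\row_k phi k z) * e i z) &
      ideal_of (s1 ++ s2) (fun z => g z - \sum_(i < d) c i 0 * e i z)].
Proof.
move=> eB s2E hphi phi0 g /holo_germP hg.
have [r [[r0 [M gM]] [K K0 hdiv]]] :=
  filter_ex (filterI (filterI (nbhs_right_gt (0 : R)) hg) (series_division eB)).
have [Q QP] : exists Q : cfun R n -> R -> division s1 s2 d,
    forall g M, absconv r g M -> divided e r (K * M) g (Q g M).
  have H (x : cfun R n * R) : exists y : division s1 s2 d,
      absconv r x.1 x.2 -> divided e r (K * x.2) x.1 y.
    move: x=> [f N]; have [/hdiv [y hy]|nf] := pselect (absconv r f N); first by exists y.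
    (* A default value, for pairs that do not bound a convergent series. *)
    by exists (@Division _ _ s1 s2 d (fun=> 0) (fun _ _ => 0) (fun _ _ => 0)) => /nf.
  by have /choice [Q hQ] := H; exists (fun f N => Q (f, N)) => f N /(hQ (f, N)).
pose p : R := (size s2)%:R.
have p0 : 0 <= p by rewrite ler0n.
have D0 : 0 < 2 * (p * K + 1) by rewrite mulr_gt0 // ltr_wpDl // mulr_ge0.
(* The ratio is then [p K / (2 (p K + 1))], below 1/2; the added 1 keeps the denominator positive
   when [p K = 0]. *)
pose rho := (2 * (p * K + 1))^-1; have rho0 : 0 < rho by rewrite invr_gt0.
have q1 : p * (rho * K) < 1.
  rewrite mulrCA mulrC ltr_pdivrMr // mul1r.
  by have := mulr_ge0 p0 K0; lra.
have phi_small : \forall s \near (0 : R)^'+, forall k, absconv s (phi k) rho.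
  by apply: filter_forall => k; apply: near_absconv_small.
have [s [[s0 sr] phis]] :=
  filter_ex (filterI (filterI (nbhs_right_gt (0 : R)) (nbhs_right_le r0)) phi_small).
have s2E' (m : 'I_(size s2)) z : s2`_m z = phi (idx m) z by rewrite s2E.
exists (limit_coef idx K Q g M); split.
- by move=> i; apply: (absconv_holo rho0); apply: (limit_coef_bound idx K0 QP rho0 q1 i gM).
- by move=> i w w'; apply: limit_coef_dep.
- exists (limit_ideal_part K Q g M).
    move=> l; apply: (absconv_holo s0).
    apply: (limit_ideal_part_bound s2E' r0 K0 QP rho0 s0 sr phis q1 l gM).
  apply/near_cubeP; exists s => // z; rewrite subr0 => zs.
  by rewrite {1}(limit_division s2E' r0 K0 QP rho0 s0 sr phis q1 gM zs) addrAC subrr add0r.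
(* The first division alone gives this congruence, as its constants [qc] are the values of the limit
   coefficients at 0. *)
- have [_ ha hb hgz] := QP _ _ gM.
  have h : ideal_of (s1 ++ s2) (fun z =>
     \sum_(l < size s1) qa (Q g M) l z * s1`_l z +
     \sum_(m < size s2) qb (Q g M) m z * s2`_m z).
    apply: idealD; [apply: ideal_catl|apply: ideal_catr].
      by apply: ideal_sum => l _; exact: (idealM (absconv_holo r0 (ha l)) (ideal_gen (ltn_ord l))).
    by apply: ideal_sum => m _; exact: (idealM (absconv_holo r0 (hb m)) (ideal_gen (ltn_ord m))).
  apply: ideal_near h; apply/near_cubeP; exists r => // z; rewrite subr0 => /hgz ->.
  rewrite /combination; under [X in _ = _ - X]eq_bigr do rewrite limit_coef0.
  by rewrite -[X in _ = X - _]addrA [RHS]addrAC subrr add0r.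
Qed.
End Preparation.

(** * Elimination *)

Section HoloPoly.
Variables (R : realType) (n : nat).
Local Notation C := R[i].
Implicit Types (p : 'rV[C]_n -> {poly C}).

(** Polynomials over O_{n,0}, encoded pointwise so that [\det] and [char_poly] apply at each point.
    They provide the coefficients of the Weierstrass polynomial. *)
Definition holo_poly p := forall l, holo_germ (fun z => (p z)`_l).

Lemma holo_polyM p1 p2 : holo_poly p1 -> holo_poly p2 -> holo_poly (fun z => p1 z * p2 z).
Proof.
move=> h1 h2 l.
apply: (@holo_ext _ _ (fun z => \sum_(i < l.+1) (p1 z)`_i * (p2 z)`_(l - i))).
  by move=> z; rewrite coefM.
by apply: holo_sum => i _; exact: (holoM (h1 i) (h2 (l - i)%N)).
Qed.

Lemma holo_poly_det d (P : 'rV[C]_n -> 'M[{poly C}]_d) :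
  (forall i j, holo_poly (fun z => P z i j)) -> holo_poly (fun z => \det (P z)).
Proof.
move=> hP l.
apply: (@holo_ext _ _ (fun z => \sum_(s : 'S_d) ((-1) ^+ s * \prod_i P z i (s i))`_l)).
  by move=> z; rewrite coef_sum.
apply: holo_sum => s _; apply: (holo_polyM (p1 := fun=> (-1) ^+ s)) => [k|].
  exact: holo_cst.
elim: (index_enum _) => [|i r IH] k.
  apply: (@holo_ext _ _ (fun=> (1 : {poly C})`_k)); last exact: holo_cst.
  by move=> z; rewrite big_nil.
apply: (@holo_ext _ _ (fun z => (P z i (s i) * \prod_(j <- r) P z j (s j))`_k)).
  by move=> z; rewrite big_cons.
exact: (holo_polyM (hP i (s i)) IH).
Qed.

Lemma holo_char_poly d (A : 'rV[C]_n -> 'M[C]_d) :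
  (forall i j, holo_germ (fun z => A z i j)) -> holo_poly (fun z => char_poly (A z)).
Proof.
move=> hA; apply: holo_poly_det => i j k.
apply: (@holo_ext _ _ (fun z => ('X *+ (i == j))`_k - (A z i j) * (k == 0%N)%:R)).
  by move=> z; rewrite !mxE coefB coefC; case: (k == 0%N); rewrite ?mulr1 ?mulr0.
apply: (holoD (holo_cst n _)); apply: holoN; exact: (holoM (hA i j) (holo_cst n _)).
Qed.
End HoloPoly.

Lemma depends_fromW (R : realType) n p (f : cfun R n) :
  (forall z z' : 'rV[R[i]]_n, (forall i : 'I_n, (p <= i)%N -> z 0 i = z' 0 i) -> f z = f z') ->
  depends_from p f.
Proof.
move=> h; exists (setT, setT) => [|[z z'] _]; last exact: h.
by split; exact: filterT.
Qed.

Section Elimination.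
Variables (R : realType) (n : nat) (j : 'I_n).
Local Notation C := R[i].
Variables (phi : n.-tuple (cfun R n)) (s1 : seq (cfun R n)).
Hypothesis phi_holo : forall i, holo_germ (tnth phi i).
Hypothesis phi0 : forall i, tnth phi i 0 = 0.
Local Notation s2 := (drop j.+1 phi).
Variables (d : nat) (e : 'I_d -> cfun R n).
Hypothesis eB : quot_basis (ideal_of (s1 ++ s2)) e.

Lemma elimination : exists h : cfun R n,
  [/\ holo_germ h, depends_from j h, ideal_of s1 (h \o map_of phi),
      ord_coord j h d & weierstrass_poly j h].
Proof.
have idx_lt (m : 'I_(size s2)) : (j.+1 + m < n)%N.
  have E : size s2 = (n - j.+1)%N by rewrite size_drop size_tuple.
  by rewrite -ltn_subRL -E.
pose idx m := Ordinal (idx_lt m).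
have s2E (m : 'I_(size s2)) : s2`_m = tnth phi (idx m).
  by rewrite nth_drop (tnth_nth 0).
have prep := weierstrass_preparation eB s2E phi_holo phi0.
have /choice [c hc] i := prep _ (holoM (phi_holo j) (basis_holo eB i)).
(* This writes 1 as a combination of [e], as the determinant trick requires. *)
have [c1 [c1_holo _ c1_span _]] := prep _ (holo_cst n 1).
pose A (w : 'rV[C]_n) : 'M[C]_d := \matrix_(i, k) c i k w.
have A_holo i k : holo_germ (fun w => A w i k).
  by apply: (@holo_ext _ _ (c i k)) => [w|]; [rewrite mxE | case: (hc i)].
have A_dep (w w' : 'rV[C]_n) : (forall i : 'I_n, (j < i)%N -> w 0 i = w' 0 i) -> A w = A w'.
  move=> ww'; apply/matrixP => i k; rewrite !mxE; case: (hc i) => _ + _ _; apply.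
  by move=> m; apply: ww' => /=; rewrite leq_addr.
have A0 : char_poly (A 0) = 'X^d.
  apply: (basis_char_poly eB (phi_holo j) (phi0 j)) => i.
  case: (hc i) => _ _ _; apply: ideal_ext => z; congr (_ - _).
  by apply: eq_bigr => k _; rewrite mxE.
(* By [det_char_poly] this is also the determinant of [w_j - A w]. That form gives holomorphy and
   membership in the ideal; the polynomial form gives the order and the Weierstrass shape. *)
pose h (w : 'rV[C]_n) := (char_poly (A w)).[w 0 j].
exists h; split.
- apply: (@holo_ext _ _ (fun w => \det ((w 0 j)%:M - A w))).
    by move=> w; rewrite det_char_poly.
  apply: holo_det => i k.
  apply: (@holo_ext _ _ (fun w => w 0 j * (i == k)%:R - A w i k)).
    by move=> w; rewrite !mxE mulr_natr.
  by apply: holoD; [exact: (holoM (holo_coord R j) (holo_cst n _)) | exact: holoN].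
- apply: depends_fromW => w w' ww'; rewrite /h (A_dep w w') ?ww' // => i /ltnW.
  exact: ww'.
- have : ideal_of s1 (fun z => \det ((tnth phi j z)%:M - A (\row_k tnth phi k z))).
    have A_comp i k : holo_germ (fun z => A (\row_k tnth phi k z) i k).
      exact: (holo_comp (A_holo i k) phi_holo phi0).
    apply: (ideal_det (B := fun z => (tnth phi j z)%:M - A (\row_k tnth phi k z))
      (e := e) (c := fun i z => c1 i (\row_k tnth phi k z)) _ _ _ c1_span).
    + move=> i k.
      apply: (@holo_ext _ _ (fun z => tnth phi j z * (i == k)%:R - A (\row_k tnth phi k z) i k)).
        by move=> w; rewrite !mxE mulr_natr.
      by apply: holoD; [exact: (holoM (phi_holo j) (holo_cst n _)) | exact: holoN].
    + by move=> i; exact: (holo_comp (c1_holo i) phi_holo phi0).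
    + move=> i; case: (hc i) => _ _ + _; apply: ideal_ext => z.
      rewrite [RHS](eq_bigr (fun k => (tnth phi j z)%:M i k * e k z -
        A (\row_k tnth phi k z) i k * e k z)).
        rewrite sumrB; congr (_ - _); last by apply: eq_bigr => k _; rewrite mxE.
        rewrite (bigD1 i) //= mxE eqxx mulr1n big1 ?addr0 // => k.
        by rewrite mxE eq_sym => /negbTE->; rewrite mulr0n mul0r.
      by move=> k _; rewrite !mxE mulrBl.
  by apply: ideal_ext => z; rewrite det_char_poly /h /= /map_of mxE.
(* On the axis of [w_j] the matrix is constantly [A 0], since it depends on later coordinates only;
   so [h] is exactly [t ^ d] there. *)
- exists (fun=> 1); first by split; [exact: holo_cst | exact: oner_neq0].
  near=> t; rewrite mulr1 /h (A_dep _ 0) => [|i ji].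
    by rewrite A0 hornerXn !mxE !eqxx mulr1.
  by rewrite !mxE eqxx -val_eqE /= gtn_eqF // mulr0.
(* The lower coefficients vanish at 0 because the characteristic polynomial of [A 0] is the pure
   power of degree [d]. *)
- exists d, (fun l w => (char_poly (A w))`_l); split=> [l|].
    split; first exact: holo_char_poly.
      by apply: depends_fromW => w w' ww'; rewrite (A_dep w w').
    by rewrite A0 coefXn ltn_eqF.
  near=> z; rewrite /h horner_coef size_char_poly big_ord_recr /= addrC.
  congr (_ + _); have := char_poly_monic (A z); rewrite monicE lead_coefE size_char_poly /=.
  by move/eqP->; rewrite mul1r.
Unshelve. all: end_near. Qed.
End Elimination.

(** * Multiplicities *)

Section Mult.
Variables (R : realType) (n : nat).
Local Notation C := R[i].
Implicit Types s : seq (cfun R n).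

(** With [n] functions the tuples of linear forms are empty, so the minimum runs over a single
    ideal. *)
Lemma mult_full s : size s = n -> mult s = quot_dim (ideal_of s).
Proof.
move=> sn; rewrite /mult [X in ereal_inf X](_ : _ = [set quot_dim (ideal_of s)]).
  exact: ereal_inf1.
apply/seteqP; split=> [_ [L _ <-]|_ ->] /=.
  have /size0nil-> : size L = 0%N by rewrite size_tuple sn subnn.
  by rewrite cats0.
pose L := nseq_tuple (n - size s) (\0 : linform R n).
exists L => //; have /size0nil-> : size L = 0%N by rewrite size_tuple sn subnn.
by rewrite cats0.
Qed.

(** A finite infimum comes from a nonempty set of naturals and is attained at its least element. *)
Lemma quot_dim_fin (I : set (cfun R n)) : (quot_dim I < +oo)%E ->
  exists d, (exists e : 'I_d -> cfun R n, quot_basis I e) /\ quot_dim I = d%:R%:E.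
Proof.
move=> fin.
have ex : exists d, `[< exists e : 'I_d -> cfun R n, quot_basis I e >].
  apply/not_existsP => none; move: fin; rewrite /quot_dim.
  rewrite [X in ereal_inf X](_ : _ = set0) ?ereal_inf0 ?ltxx //.
  by rewrite -subset0 => x [d [e hb] _]; apply: (none d); apply/asboolP; exists e.
case: (ex_minnP ex) => d /asboolP hd dmin.
exists d; split=> //; apply/eqP; rewrite eq_le; apply/andP; split.
  by apply: ereal_inf_lbound; exists d.
by apply/ereal_infP => _ [d' hd' <-]; rewrite lee_fin ler_nat; apply: dmin; apply/asboolP.
Qed.

(** Every element of the ideal vanishes at 0, so 1 is outside it, whereas an empty basis would put 1
    inside. *)
Lemma quot_dim_ge1 s : (forall l, (l < size s)%N -> s`_l 0 = 0) -> (1 <= quot_dim (ideal_of s))%E.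
Proof.
move=> s0; apply/ereal_infP => _ [d [e eB] <-]; rewrite lee_fin ler1n lt0n.
apply/negP => /eqP d0; have [c /= [a _ /nbhs_singleton]] := basis_span eB (holo_cst n 1).
rewrite !big1 => [/eqP|i _|i _]; first by rewrite subr0 oner_eq0.
  by rewrite s0 ?mulr0.
by exfalso; case: i => m; rewrite d0.
Qed.

Lemma mult_ge1 s : (forall l, (l < size s)%N -> s`_l 0 = 0) -> (1 <= mult s)%E.
Proof.
move=> s0; apply/ereal_infP => _ [L _ <-]; apply: quot_dim_ge1 => l.
rewrite size_cat size_map nth_cat => ll; case: ltnP => ls; first exact: s0.
have lL : (l - size s < size L)%N.
  by rewrite ltn_subLR.
by rewrite (nth_map (\0 : linform R n)) // linear0.
Qed.
End Mult.

(** * The triangular resolution and the bound on its orders *)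

Theorem proposition5p1 (R : realType) (n k : nat)
    (hk : (1 <= k)%N) (hkn : (k <= n)%N)
    (f : k.-tuple ('rV[R[i]]_n -> R[i])) (phi : n.-tuple ('rV[R[i]]_n -> R[i]))
    (f_holo : forall j : 'I_k, holo_germ (tnth f j))
    (phi_holo : forall j : 'I_n, holo_germ (tnth phi j))
    (phi0 : forall j : 'I_n, tnth phi j 0%R = 0%R)
    (mu_fin : forall j : 'I_k,
      (mult (take j.+1 f ++ drop j.+1 phi) < +oo)%E) :
  exists (nu : 'I_k -> nat) (h : 'I_k -> 'rV[R[i]]_n -> R[i]),
    [/\ triangular_resolution hkn (map_of phi)
          (fun j : 'I_k => ideal_of (take j.+1 f)) nu h,
        forall j : 'I_k,
          ((nu j)%:R%:E <=
             n%:R%:E * mult (take j.+1 f ++ drop j.+1 phi) *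
             mult (take j.+1 f))%E &
        forall j : 'I_k, weierstrass_poly (widen_ord hkn j) (h j)].
Proof.
have sz (j : 'I_k) : size (take j.+1 f ++ drop j.+1 phi) = n.
  rewrite size_cat size_take size_drop !size_tuple; have jk := ltn_ord j.
  have -> : (if (j.+1 < k)%N then j.+1 else k) = j.+1.
    by case: ltnP => // kj; apply/eqP; rewrite eqn_leq kj jk.
  by rewrite subnKC // (leq_trans jk).
have H (j : 'I_k) : exists x : nat * cfun R n,
    [/\ [/\ holo_germ x.2, depends_from j x.2, ideal_of (take j.+1 f) (x.2 \o map_of phi) &
        ord_coord (widen_ord hkn j) x.2 x.1],
      (x.1%:R%:E <= n%:R%:E * mult (take j.+1 f ++ drop j.+1 phi) * mult (take j.+1 f))%E &
      weierstrass_poly (widen_ord hkn j) x.2].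
  have := mu_fin j; rewrite mult_full // => /quot_dim_fin [d [[e eB] ->]].
  have [h [h1 h2 h3 h4 h5]] := elimination (j := widen_ord hkn j) phi_holo phi0 eB.
  exists (d, h); split=> //=.
  (* For [d = 0] both sides are 0, even if the last multiplicity is [+oo], as 0 times [+oo] is 0. *)
  have [->|d0] := posnP d; first by rewrite mule0 mul0e.
  (* For [d > 0] each of these functions vanishes at 0; otherwise it would be a unit of the ideal
     and the quotient would be zero. *)
  have f0 l : (l < size (take j.+1 f))%N -> (take j.+1 f)`_l 0 = 0.
    move=> ll.
    apply/eqP/negPn/negP => fl.
    have lk : (l < k)%N.
      by apply: leq_trans ll _; rewrite size_take size_tuple; case: ltnP => // /ltnW.
    have lj : (l < j.+1)%N.
      by apply: leq_trans ll _; rewrite size_take; case: ltnP.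
    have hl : holo_germ (take j.+1 f)`_l.
      have fE : tnth f (Ordinal lk) = (take j.+1 f)`_l by rewrite nth_take // (tnth_nth 0).
      by rewrite -fE; exact: f_holo.
    have := basis_ideal1 eB (ideal_unit hl fl (ideal_catl _ (ideal_gen ll))).
    by move=> d00; rewrite d00 in d0.
  have n0 : (0 < n)%N by exact: leq_trans hk hkn.
  (* The order is [d * 1], compared factor by factor: [d <= n * d] since [n] is positive, and the
     multiplicity of [f_1, ..., f_j] is at least 1. *)
  rewrite -[leLHS]mule1; apply: lee_pmul; rewrite ?lee_fin ?ler0n //.
    by rewrite -natrM ler_nat leq_pmull.
  exact: mult_ge1.
have /choice [x hx] := H.
by exists (fun j => (x j).1), (fun j => (x j).2); split=> j; case: (hx j).
Qed.
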